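(* Let $S$ and $T$ be ultramatricial algebras over a semifield $F$. Then there exists a group isomorphism $f \colon K_0(S) \to K_0(T)$ such that $f([S]) = [T]$ and $f(K_0(S)^+) = K_0(T)^+$ if and only if $S \cong T$ as $F$-algebras.
   Context: A semiring $(S,+,\cdot,0,1)$ consists of a commutative monoid $(S,+,0)$ and a monoid $(S,\cdot,1)$ such that multiplication distributes over addition on both sides and $0s=0=s0$. A semifield is a commutative semiring $F$ with $(F\setminus\{0\},\cdot,1)$ a group. A (unital) $F$-algebra is an $F$-semimodule with an associative $F$-bilinear multiplication with identity element. A matricial $F$-algebra is an $F$-algebra isomorphic to $M_{n_1}(F)\times\cdots\times M_{n_r}(F)$ for some positive integers $n_1,\dots,n_r$. An $F$-algebra is ultramatricial if it is isomorphic to the direct limit, in the category of unital $F$-algebras, of a sequence $S_1\to S_2\to\cdots$ of matricial $F$-algebras. Right $S$-semimodules are commutative monoids with a unital, biadditive, associative right action of $S$ with $0_Ms=0_M=m0$. A finitely generated projective right $S$-semimodule is a retract of $S^n$ for some $n$ (i.e. a semimodule $P$ with homomorphisms $f\colon S^n\to P$, $g\colon P\to S^n$ such that $f\circ g=\mathrm{id}_P$). $K_0(S)$ is the Grothendieck group of the commutative monoid of isomorphism classes of finitely generated projective right $S$-semimodules under direct sum; $[P]$ denotes the class of $P$ in $K_0(S)$, and $K_0(S)^+=\{[P]\mid P\text{ finitely generated projective}\}$. *)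

(* Defs.v *)
From HB Require Import structures.
From mathcomp Require Import all_boot all_order all_algebra.
From mathcomp Require Import boolp.

Set Implicit Arguments.
Unset Strict Implicit.
Unset Printing Implicit Defensive.

Import GRing.Theory.
Local Open Scope ring_scope.

(* F \ {0} is a group under multiplication; 1 != 0 and commutativity come from
   [comNzSemiRingType], and inverses make F \ {0} closed under products. *)
Definition semifield (F : comNzSemiRingType) : Prop :=
  forall x : F, x != 0 -> exists2 y : F, y != 0 & x * y = 1.

Definition alg_iso (F : comNzSemiRingType) (A B : semiAlgType F) : Prop :=
  exists f : {lrmorphism A -> B}, bijective f.

(* M_{n_1}(F) x ... x M_{n_r}(F) with r = 1 + size s; as the sizes are
   positive, the arguments list the predecessors n_i - 1. *)
Fixpoint matrix_prod (F : comNzSemiRingType) (n : nat) (s : seq nat) :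
    semiAlgType F :=
  match s with
  | [::] => 'M[F]_n.+1
  | m :: s' => ('M[F]_n.+1 * matrix_prod F m s')%type
  end.

Definition matricial (F : comNzSemiRingType) (A : semiAlgType F) : Prop :=
  exists (n : nat) (s : seq nat), alg_iso A (matrix_prod F n s).

Definition is_cocone (F : comNzSemiRingType) (A : nat -> semiAlgType F)
    (phi : forall i, {lrmorphism A i -> A i.+1})
    (B : semiAlgType F) (psi : forall i, {lrmorphism A i -> B}) : Prop :=
  forall i (x : A i), psi i.+1 (phi i x) = psi i x.

(* A [semiAlgType] is nontrivial (1 != 0). This changes nothing here: exactly
   one map goes from any algebra to the trivial one, and the limit of a
   sequence of nontrivial algebras along unital maps is nontrivial. *)
Definition is_direct_limit (F : comNzSemiRingType) (A : nat -> semiAlgType F)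
    (phi : forall i, {lrmorphism A i -> A i.+1})
    (L : semiAlgType F) (psi : forall i, {lrmorphism A i -> L}) : Prop :=
  is_cocone phi psi /\
  forall (B : semiAlgType F) (chi : forall i, {lrmorphism A i -> B}),
    is_cocone phi chi ->
    exists h : {lrmorphism L -> B},
      (forall i (x : A i), h (psi i x) = chi i x) /\
      (forall h' : {lrmorphism L -> B},
         (forall i (x : A i), h' (psi i x) = chi i x) -> h' =1 h).

Definition ultramatricial (F : comNzSemiRingType) (S : semiAlgType F) : Prop :=
  exists (A : nat -> semiAlgType F) (phi : forall i, {lrmorphism A i -> A i.+1})
         (L : semiAlgType F) (psi : forall i, {lrmorphism A i -> L}),
    [/\ forall i, matricial (A i), is_direct_limit phi psi & alg_iso S L].

(* Right S-semimodules are left semimodules over the converse semiring S^c;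
   in particular S^n is 'rV[S^c]_n, and S itself is the regular one S^c^o. *)
Notation rSemiModType S := (lSemiModType S^c).

Definition smod_iso (S : nzSemiRingType) (P Q : rSemiModType S) : Prop :=
  exists f : {linear P -> Q}, bijective f.

Definition is_fgproj (S : nzSemiRingType) (P : rSemiModType S) : Prop :=
  exists (n : nat) (f : {linear 'rV[S^c]_n -> P})
         (g : {linear P -> 'rV[S^c]_n}), cancel g f.

Record fgproj (S : nzSemiRingType) := FGProj {
  fgproj_mod :> rSemiModType S;
  fgprojP : is_fgproj fgproj_mod
}.

(* Quotients by an equivalence relation. The type [fgproj S] lies in a universe
   above those of the MathComp structures, so that neither [generic_quotient]
   nor [nmodType] and [zmodType] apply to what is built from it. *)
Section Quotient.

Variables (T : Type) (E : T -> T -> Prop).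

Definition quot : Type := {C : T -> Prop | exists x, C = E x}.

Definition qcls (x : T) : quot := exist _ (E x) (ex_intro _ x erefl).

Definition qrepr (q : quot) : T := sval (cid (svalP q)).

Lemma qreprK q : qcls (qrepr q) = q.
Proof.
rewrite /qcls /qrepr; case: cid => x /= Ex.
case: q Ex => C PC /= eqC; subst C.
by congr (exist _ _ _); exact: Prop_irrelevance.
Qed.

Definition qequiv : Prop :=
  [/\ forall x, E x x, forall x y, E x y -> E y x
    & forall x y z, E x y -> E y z -> E x z].

Lemma qcls_eq : qequiv -> forall x y, qcls x = qcls y <-> E x y.
Proof.
case=> Er Es Et x y; split=> [/(congr1 sval) /= exy | Exy].
  by rewrite exy; apply: Er.
have e : E x = E y.
  by apply/funext => z; apply/propext; split; apply: Et => //; apply: Es.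
rewrite /qcls; move: (ex_intro _ x _) (ex_intro _ y _); rewrite e => p q.
by congr (exist _ _ _); exact: Prop_irrelevance.
Qed.

Lemma qreprP : qequiv -> forall x, E (qrepr (qcls x)) x.
Proof. by move=> eqE x; apply/(qcls_eq eqE); rewrite qreprK. Qed.

End Quotient.

(* The Grothendieck group of a commutative monoid (M, add, zero): [(a, b)]
   stands for the formal difference a - b. *)
Section Grothendieck.

Variables (M : Type) (add : M -> M -> M) (zero : M).

Definition groth_rel (x y : M * M) : Prop :=
  exists k, add (add x.1 y.2) k = add (add y.1 x.2) k.

Definition groth : Type := quot groth_rel.

Definition groth_diff (a b : M) : groth := qcls groth_rel (a, b).

Definition groth_in (a : M) : groth := groth_diff a zero.

Definition groth_zero : groth := groth_diff zero zero.

Definition groth_add (x y : groth) : groth :=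
  groth_diff (add (qrepr x).1 (qrepr y).1) (add (qrepr x).2 (qrepr y).2).

Definition groth_opp (x : groth) : groth := groth_diff (qrepr x).2 (qrepr x).1.

Hypotheses (addA : associative add) (addC : commutative add).
Hypothesis (add0 : left_id zero add).

Let addAC : right_commutative add.
Proof. by move=> x y z; rewrite -!addA (addC y). Qed.

Let addCA : left_commutative add.
Proof. by move=> x y z; rewrite !addA (addC x). Qed.

Let addACA : interchange add add.
Proof. by move=> x y z t; rewrite -!addA (addCA y). Qed.

Lemma groth_rel_equiv : qequiv groth_rel.
Proof.
split=> [x | x y [k e] | x y z [k e] [l h]]; first by exists x.1.
  by exists k.
exists (add (add y.1 y.2) (add k l)).
have -> : add (add x.1 z.2) (add (add y.1 y.2) (add k l)) =
          add (add (add x.1 y.2) k) (add (add y.1 z.2) l).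
  rewrite (addACA (add x.1 y.2)) (addACA x.1 y.2) (addC y.2 z.2).
  by rewrite -(addACA x.1 z.2) -!addA.
rewrite e h (addACA (add y.1 x.2)) [RHS]addA; congr (add _ _).
by rewrite addACA (addACA z.1) (addC y.1).
Qed.

Lemma groth_diff_eq a b c d :
  groth_diff a b = groth_diff c d <->
  exists k, add (add a d) k = add (add c b) k.
Proof. exact: (qcls_eq groth_rel_equiv (a, b) (c, d)). Qed.

Lemma groth_reprE x : x = groth_diff (qrepr x).1 (qrepr x).2.
Proof. by rewrite -{1}(qreprK x) /groth_diff -surjective_pairing. Qed.

Lemma groth_add_diff a b c d :
  groth_add (groth_diff a b) (groth_diff c d) =
  groth_diff (add a c) (add b d).
Proof.
apply/groth_diff_eq.
have [k] := qreprP groth_rel_equiv (a, b).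
have [l] := qreprP groth_rel_equiv (c, d).
rewrite -/(groth_diff a b) -/(groth_diff c d).
case: (qrepr (groth_diff a b)) => a' b'.
case: (qrepr (groth_diff c d)) => c' d' /= e h.
exists (add k l).
by rewrite (addACA a') (addACA (add a' b)) e h (addACA a) (addACA (add a b')).
Qed.

Lemma groth_opp_diff a b : groth_opp (groth_diff a b) = groth_diff b a.
Proof.
apply/groth_diff_eq; have [k] := qreprP groth_rel_equiv (a, b).
rewrite -/(groth_diff a b); case: (qrepr _) => a' b' /= e; exists k.
by rewrite (addC b') (addC b).
Qed.

Lemma groth_in_eq a b :
  groth_in a = groth_in b <-> exists k, add a k = add b k.
Proof.
rewrite groth_diff_eq; split=> -[k e]; exists k.
  by move: e; rewrite -!(addC zero) !add0.
by rewrite -!(addC zero) !add0.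
Qed.

Lemma groth_inD a b : groth_in (add a b) = groth_add (groth_in a) (groth_in b).
Proof. by rewrite groth_add_diff add0. Qed.

Lemma groth_addA : associative groth_add.
Proof.
move=> x y z; rewrite (groth_reprE x) (groth_reprE y) (groth_reprE z).
by rewrite !groth_add_diff !addA.
Qed.

Lemma groth_addC : commutative groth_add.
Proof. by move=> x y; rewrite /groth_add addC [add _.2 _]addC. Qed.

Lemma groth_add0 : left_id groth_zero groth_add.
Proof. by move=> x; rewrite (groth_reprE x) groth_add_diff !add0. Qed.

Lemma groth_addN : left_inverse groth_zero groth_opp groth_add.
Proof.
move=> x; rewrite (groth_reprE x) groth_opp_diff groth_add_diff.
apply/groth_diff_eq; exists zero; move: (qrepr x).1 (qrepr x).2 => a b.
by rewrite add0 (addC b) (addC _ zero) add0.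
Qed.

End Grothendieck.

Section FGProj.

Variable S : nzSemiRingType.
Implicit Types P Q R : rSemiModType S.

Lemma linear_pack P Q (g : P -> Q) :
  semilinear g -> exists gL : {linear P -> Q}, gL =1 g.
Proof.
move=> lg; pose gM := GRing.isSemilinear.Build _ _ _ _ g lg.
by exists (HB.pack g gM : {linear P -> Q}).
Qed.

Lemma smod_isoP P Q (f : P -> Q) (g : Q -> P) :
  semilinear f -> cancel f g -> cancel g f -> smod_iso P Q.
Proof.
move=> /linear_pack[fL fE] fK gK; exists fL.
by exists g => x; rewrite !fE.
Qed.

Lemma smod_iso_refl P : smod_iso P P.
Proof. by apply: (@smod_isoP _ _ id id). Qed.

Lemma smod_iso_sym P Q : smod_iso P Q -> smod_iso Q P.
Proof.
by move=> [f [g fK gK]]; apply: (smod_isoP _ gK fK); apply: can2_semilinear gK.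
Qed.

Lemma smod_iso_trans P Q R : smod_iso P Q -> smod_iso Q R -> smod_iso P R.
Proof.
by move=> [f bf] [g bg]; exists (g \o f); apply: bij_comp.
Qed.

Lemma smod_iso_equiv : qequiv (fun P Q : fgproj S => smod_iso P Q).
Proof.
split=> [P | P Q | P Q R].
- exact: smod_iso_refl.
- exact: smod_iso_sym.
- exact: smod_iso_trans.
Qed.

Lemma smod_iso_dsum P P' Q Q' :
  smod_iso P P' -> smod_iso Q Q' -> smod_iso (P * Q)%type (P' * Q')%type.
Proof.
move=> [f [f' fK f'K]] [g [g' gK g'K]].
apply: (@smod_isoP (P * Q)%type (P' * Q')%type
  (fun x => (f x.1, g x.2)) (fun x => (f' x.1, g' x.2))).
- by split=> [a [x y] | [x y] [z t]] /=; rewrite ?linearZ ?linearD.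
- by case=> x y /=; rewrite fK gK.
- by case=> x y /=; rewrite f'K g'K.
Qed.

Lemma is_fgproj0 : is_fgproj ('rV[S^c]_0 : rSemiModType S).
Proof. by exists 0, idfun, idfun. Qed.

Lemma is_fgproj1 : is_fgproj (S^c^o : rSemiModType S).
Proof.
have [f fE] : exists f : {linear 'rV[S^c]_1 -> S^c^o}, forall v, f v = v 0 0.
  by apply: linear_pack; split=> [a v | u v]; rewrite !mxE.
have [g gE] : exists g : {linear S^c^o -> 'rV[S^c]_1},
    forall x, g x = const_mx x.
  by apply: linear_pack; split=> [a v | u v]; apply/matrixP => i j; rewrite !mxE.
by exists 1, f, g => x; rewrite fE gE mxE.
Qed.

Lemma is_fgprojD P Q :
  is_fgproj P -> is_fgproj Q -> is_fgproj ((P * Q)%type : rSemiModType S).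
Proof.
move=> [m [f [g fK]]] [n [f' [g' fK']]].
have [h hE] : exists h : {linear 'rV[S^c]_(m + n) -> (P * Q)%type},
    forall v, h v = (f (lsubmx v), f' (rsubmx v)).
  by apply: linear_pack; split=> [a v | u v];
    rewrite !(linearZ, linearD, raddfD) //=.
have [k kE] : exists k : {linear (P * Q)%type -> 'rV[S^c]_(m + n)},
    forall x, k x = row_mx (g x.1) (g' x.2).
  by apply: linear_pack; split=> [a v | u v];
    rewrite /= !(linearZ, linearD) ?scale_row_mx ?add_row_mx.
exists (m + n)%N, h, k => -[x y].
by rewrite hE kE row_mxKl row_mxKr fK fK'.
Qed.

Definition fgproj0 : fgproj S := FGProj is_fgproj0.

Definition fgproj_regular : fgproj S := FGProj is_fgproj1.

Definition fgproj_dsum (P Q : fgproj S) : fgproj S :=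
  FGProj (is_fgprojD (fgprojP P) (fgprojP Q)).

Definition iso_class : Type := quot (fun P Q : fgproj S => smod_iso P Q).

Definition to_iso_class (P : fgproj S) : iso_class := qcls _ P.

Definition iso_class_add (a b : iso_class) : iso_class :=
  to_iso_class (fgproj_dsum (qrepr a) (qrepr b)).

Lemma to_iso_class_eq (P Q : fgproj S) :
  to_iso_class P = to_iso_class Q <-> smod_iso P Q.
Proof. exact: (qcls_eq smod_iso_equiv). Qed.

Lemma to_iso_classD (P Q : fgproj S) :
  to_iso_class (fgproj_dsum P Q) =
  iso_class_add (to_iso_class P) (to_iso_class Q).
Proof.
apply/to_iso_class_eq/smod_iso_sym.
by apply: smod_iso_dsum; apply: (qreprP smod_iso_equiv).
Qed.

Lemma iso_class_reprE a : a = to_iso_class (qrepr a).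
Proof. by rewrite /to_iso_class qreprK. Qed.

Lemma iso_class_addA : associative iso_class_add.
Proof.
move=> a b c; rewrite (iso_class_reprE a) (iso_class_reprE b).
rewrite (iso_class_reprE c) -!to_iso_classD.
apply/to_iso_class_eq => /=.
move: (qrepr a) (qrepr b) (qrepr c) => P Q R.
apply: (@smod_isoP (P * (Q * R))%type ((P * Q) * R)%type
  (fun x => ((x.1, x.2.1), x.2.2)) (fun x => (x.1.1, (x.1.2, x.2)))) => //.
- by case=> x [y z].
- by case=> [[x y] z].
Qed.

Lemma iso_class_addC : commutative iso_class_add.
Proof.
move=> a b; apply/to_iso_class_eq => /=.
move: (qrepr a) (qrepr b) => P Q.
by apply: (@smod_isoP (P * Q)%type (Q * P)%type
  (fun x => (x.2, x.1)) (fun x => (x.2, x.1))) => //; case.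
Qed.

Lemma iso_class_add0 : left_id (to_iso_class fgproj0) iso_class_add.
Proof.
move=> a; rewrite (iso_class_reprE a) -to_iso_classD.
apply/to_iso_class_eq => /=; move: (qrepr a) => P.
apply: (@smod_isoP ('rV[S^c]_0 * P)%type P snd (fun x => (0, x))) => //.
by case=> x y; congr pair; apply/matrixP => i [].
Qed.

Definition K0 : Type := groth iso_class_add.

Definition K0_zero : K0 := groth_zero iso_class_add (to_iso_class fgproj0).

Definition K0_add : K0 -> K0 -> K0 := @groth_add _ iso_class_add.

Definition K0_opp : K0 -> K0 := @groth_opp _ iso_class_add.

Definition K0_class (P : fgproj S) : K0 :=
  groth_in iso_class_add (to_iso_class fgproj0) (to_iso_class P).

Definition K0_pos (x : K0) : Prop := exists P : fgproj S, x = K0_class P.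

Lemma K0_addA : associative K0_add.
Proof. exact: (groth_addA iso_class_addA iso_class_addC). Qed.

Lemma K0_addC : commutative K0_add.
Proof. exact: (groth_addC iso_class_addC). Qed.

Lemma K0_add0 : left_id K0_zero K0_add.
Proof. exact: (groth_add0 iso_class_addA iso_class_addC iso_class_add0). Qed.

Lemma K0_addN : left_inverse K0_zero K0_opp K0_add.
Proof. exact: (groth_addN iso_class_addA iso_class_addC iso_class_add0). Qed.

Lemma K0_classD (P Q : fgproj S) :
  K0_class (fgproj_dsum P Q) = K0_add (K0_class P) (K0_class Q).
Proof.
rewrite /K0_class to_iso_classD.
exact: (groth_inD iso_class_addA iso_class_addC iso_class_add0).
Qed.

Lemma K0_class_eq (P Q : fgproj S) :
  K0_class P = K0_class Q <->
  exists R : fgproj S, smod_iso (fgproj_dsum P R) (fgproj_dsum Q R).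
Proof.
rewrite (groth_in_eq iso_class_addA iso_class_addC iso_class_add0).
split=> [[k] | [R e]]; last first.
  by exists (to_iso_class R); rewrite -!to_iso_classD; apply/to_iso_class_eq.
rewrite (iso_class_reprE k) -!to_iso_classD => /to_iso_class_eq e.
by exists (qrepr k).
Qed.

Lemma K0_diff (x : K0) :
  exists P Q : fgproj S, x = K0_add (K0_class P) (K0_opp (K0_class Q)).
Proof.
exists (qrepr (qrepr x).1), (qrepr (qrepr x).2).
rewrite /K0_add /K0_opp /K0_class -!iso_class_reprE {1}(groth_reprE x).
rewrite (groth_opp_diff iso_class_addA iso_class_addC).
rewrite (groth_add_diff iso_class_addA iso_class_addC).
by rewrite iso_class_add0 iso_class_addC iso_class_add0.
Qed.

End FGProj.

Definition K0_group_iso (S T : nzSemiRingType) (f : K0 S -> K0 T) : Prop :=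
  {morph f : x y / K0_add x y >-> K0_add x y} /\ bijective f.

(* Main.v *)
Require Import Defs.
From HB Require Import structures.
From mathcomp Require Import all_boot all_order all_algebra.
From mathcomp Require Import boolp generic_quotient.

Set Implicit Arguments.
Unset Strict Implicit.
Unset Printing Implicit Defensive.

(** Elliott's intertwining argument. Everything is phrased with idempotent
    matrices. Over a matricial algebra, and hence over a direct limit of such,
    a finitely generated projective semimodule that becomes isomorphic to a
    direct summand of a free one after adding some [r] to both is isomorphic to
    it already. This cancellation is the only place where the semifield enters
    seriously: a semifield is either a field, where ranks decide, or zerosumfree
    without zero divisors. In the latter case a summand of a free semimodule is
    given by a diagonal 0-1 matrix, and a basis vector of it can only be sent
    into one of the two terms of a direct sum, which allows an induction.

    By cancellation a positive unital map between K_0 groups lifts to a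
    homomorphism from a matricial algebra into an ultramatricial one, uniquely
    up to conjugation by a unit. Such a lift is compared with the given map on
    the classes of complemented idempotents only: over a zerosumfree semifield
    K_0 also contains projectives that are not summands of free semimodules,
    and those need not be respected. *)

Import GRing.Theory.
Local Open Scope ring_scope.
Local Open Scope quotient_scope.

(** * Cancellation for idempotent matrices *)

Section IdempotentMatrices.

Variable R : nzSemiRingType.

(** Equality in K_0 is only stable isomorphism, and a positive map may send the class of a summand
    of a free semimodule to that of an arbitrary projective. Hence the asymmetry in [mx_cancel]: one
    idempotent is complemented, while the other and the added one are arbitrary. Complemented
    idempotents suffice for comparing maps because a homomorphism from M_n(F) is governed by the
    matrix units E_ii, which are complemented, and every complemented idempotent of M_n(F) is
    equivalent to a sum of them. A limit is known only by its universal property. That its elements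
    come from finite levels, and that elements identified in it agree from some level on, has to be
    extracted by testing against suitable algebras. Matricial algebras are finitely spanned, so a
    triangle made commutative in the limit by a conjugation already commutes at a finite level; this
    produces the zigzag between the two sequences. *)

Definition mx_idem m (e : 'M[R]_m) : Prop := e *m e = e.

(** Murray-von Neumann equivalence across sizes: for idempotents, an isomorphism between the
    images. *)
Definition mx_sim m n (e : 'M[R]_m) (f : 'M[R]_n) : Prop :=
  exists (x : 'M[R]_(m, n)) (y : 'M[R]_(n, m)), x *m y = e /\ y *m x = f.

(** Over a semiring an idempotent only gives a retract of a free semimodule. A complement, which
    cannot be written as 1 - p, makes it a direct summand. *)
Definition mx_compl n (p : 'M[R]_n) : Prop :=
  exists q : 'M[R]_n, [/\ p *m q = 0, q *m p = 0 & p + q = 1%:M].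

Definition mx_dsum m n (e : 'M[R]_m) (f : 'M[R]_n) : 'M[R]_(m + n) :=
  block_mx e 0 0 f.

Lemma mx_compl_idem n (p : 'M[R]_n) : mx_compl p -> mx_idem p.
Proof. by case=> q [pq _ e]; rewrite /mx_idem -{3}[p]mulmx1 -e mulmxDr pq addr0. Qed.

Lemma mx_dsum_idem m n (e : 'M[R]_m) (f : 'M[R]_n) :
  mx_idem e -> mx_idem f -> mx_idem (mx_dsum e f).
Proof.
by rewrite /mx_idem /mx_dsum mulmx_block !(mulmx0, mul0mx, addr0, add0r) => -> ->.
Qed.

Lemma mx_sim_refl m (e : 'M[R]_m) : mx_idem e -> mx_sim e e.
Proof. by move=> ee; exists e, e. Qed.

Lemma mx_sim_sym m n (e : 'M[R]_m) (f : 'M[R]_n) : mx_sim e f -> mx_sim f e.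
Proof. by case=> x [y [xy yx]]; exists y, x. Qed.

Lemma mx_sim_trans m n k (e : 'M[R]_m) (f : 'M[R]_n) (g : 'M[R]_k) :
  mx_idem e -> mx_idem g -> mx_sim e f -> mx_sim f g -> mx_sim e g.
Proof.
move=> ee gg [x [y [xy yx]]] [z [t [zt tz]]]; exists (x *m z), (t *m y); split.
  by rewrite mulmxA -(mulmxA x) zt -yx mulmxA xy -mulmxA xy.
by rewrite mulmxA -(mulmxA t) yx -zt mulmxA tz -mulmxA tz.
Qed.

(** Cutting the witnesses down to [e *m x] and [f *m y] makes them mutually inverse maps between the
    images. *)
Lemma mx_sim_normal m n (e : 'M[R]_m) (f : 'M[R]_n) :
  mx_idem e -> mx_idem f -> mx_sim e f ->
  exists (x : 'M[R]_(m, n)) (y : 'M[R]_(n, m)),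
    [/\ x *m y = e, y *m x = f, e *m x = x, x *m f = x & f *m y = y /\ y *m e = y].
Proof.
move=> ee ff [x [y [xy yx]]]; exists (e *m x), (f *m y).
have ex : e *m x = x *m f by rewrite -xy -yx mulmxA.
have fy : f *m y = y *m e by rewrite -xy -yx mulmxA.
split.
- by rewrite {1}ex mulmxA -(mulmxA x) ff -mulmxA fy mulmxA xy ee.
- by rewrite {1}fy mulmxA -(mulmxA y) ee -mulmxA ex mulmxA yx ff.
- by rewrite mulmxA ee.
- by rewrite ex -mulmxA ff.
- by rewrite mulmxA ff; split=> //; rewrite fy -mulmxA ee.
Qed.

(* On images: adding the image of [r] can be cancelled as soon as one side,
   here [p], is a direct summand of a free module. *)
Definition mx_cancel : Prop :=
  forall m n k (P : 'M[R]_m) (p : 'M[R]_n) (r : 'M[R]_k),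
    mx_idem P -> mx_idem r -> mx_compl p ->
    mx_sim (mx_dsum P r) (mx_dsum p r) -> mx_sim P p.

(** Serves the flattening below: [(m + k) * n] is not syntactically [m * n + k * n], but equations
    between blocks transfer without casts. *)
Lemma mx_sim_dsum_blocks m n k l (P : 'M[R]_m) (p : 'M[R]_n) (r : 'M[R]_k)
    (s : 'M[R]_l) :
  mx_sim (mx_dsum P r) (mx_dsum p s) <->
  exists (x1 : 'M[R]_(m, n)) (x2 : 'M[R]_(m, l)) (x3 : 'M[R]_(k, n))
    (x4 : 'M[R]_(k, l)) (y1 : 'M[R]_(n, m)) (y2 : 'M[R]_(n, k))
    (y3 : 'M[R]_(l, m)) (y4 : 'M[R]_(l, k)),
    [/\ x1 *m y1 + x2 *m y3 = P, x1 *m y2 + x2 *m y4 = 0,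
        x3 *m y1 + x4 *m y3 = 0 & x3 *m y2 + x4 *m y4 = r] /\
    [/\ y1 *m x1 + y2 *m x3 = p, y1 *m x2 + y2 *m x4 = 0,
        y3 *m x1 + y4 *m x3 = 0 & y3 *m x2 + y4 *m x4 = s].
Proof.
split=> [[x [y]] | [x1 [x2 [x3 [x4 [y1 [y2 [y3 [y4 [ex ey]]]]]]]]]].
  rewrite -(submxK x) -(submxK y) !mulmx_block /mx_dsum => -[ex ey].
  exists (ulsubmx x), (ursubmx x), (dlsubmx x), (drsubmx x).
  exists (ulsubmx y), (ursubmx y), (dlsubmx y), (drsubmx y); split.
    by case/eq_block_mx: ex => -> -> -> ->.
  by case/eq_block_mx: ey => -> -> -> ->.
exists (block_mx x1 x2 x3 x4), (block_mx y1 y2 y3 y4).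
by rewrite !mulmx_block; case: ex => -> -> -> ->; case: ey => -> -> -> ->.
Qed.

End IdempotentMatrices.

Lemma map_mx_dsum (R R' : nzSemiRingType) (f : {rmorphism R -> R'}) m n
    (e : 'M[R]_m) (g : 'M[R]_n) :
  map_mx f (mx_dsum e g) = mx_dsum (map_mx f e) (map_mx f g).
Proof. by rewrite /mx_dsum map_block_mx !map_mx0. Qed.

Lemma map_mx_idem (R R' : nzSemiRingType) (f : {rmorphism R -> R'}) m
    (e : 'M[R]_m) : mx_idem e -> mx_idem (map_mx f e).
Proof. by rewrite /mx_idem -map_mxM => ->. Qed.

Lemma map_mx_sim (R R' : nzSemiRingType) (f : {rmorphism R -> R'}) m n
    (e : 'M[R]_m) (g : 'M[R]_n) :
  mx_sim e g -> mx_sim (map_mx f e) (map_mx f g).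
Proof.
by case=> x [y [<- <-]]; exists (map_mx f x), (map_mx f y); rewrite -!map_mxM.
Qed.

Lemma map_mx_compl (R R' : nzSemiRingType) (f : {rmorphism R -> R'}) n
    (p : 'M[R]_n) : mx_compl p -> mx_compl (map_mx f p).
Proof.
case=> q [pq qp e]; exists (map_mx f q).
by rewrite -!map_mxM -map_mxD pq qp e map_mx1 map_mx0.
Qed.

(** * Cancellation over a product of semirings *)

Section PairMatrix.

Variables R R' : nzSemiRingType.

Definition pair_mx m n (X : 'M[R]_(m, n)) (Y : 'M[R']_(m, n)) :
  'M[(R * R')%type]_(m, n) := \matrix_(i, j) (X i j, Y i j).

Lemma pair_mxM m n k (X : 'M[R]_(m, n)) Y (Z : 'M[R]_(n, k)) T :
  pair_mx X Y *m pair_mx Z T = pair_mx (X *m Z) (Y *m T).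
Proof.
apply/matrixP=> i j; rewrite !mxE.
have /= e1 := raddf_sum (@fst R R'); have /= e2 := raddf_sum (@snd R R').
rewrite [LHS]surjective_pairing e1 e2; congr pair;
  by apply: eq_bigr => s _; rewrite !mxE.
Qed.

Lemma mx_sim_pair m n (e1 : 'M[(R * R')%type]_m) (e2 : 'M[(R * R')%type]_n) :
  mx_sim (map_mx fst e1) (map_mx fst e2) ->
  mx_sim (map_mx snd e1) (map_mx snd e2) -> mx_sim e1 e2.
Proof.
move=> [x [y [xy yx]]] [z [t [zt tz]]]; exists (pair_mx x z), (pair_mx y t).
rewrite !pair_mxM xy yx zt tz.
by split; apply/matrixP=> i j; rewrite !mxE -surjective_pairing.
Qed.

Lemma mx_cancel_prod :
  mx_cancel R -> mx_cancel R' -> mx_cancel (R * R')%type.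
Proof.
move=> cR cR' m n k P p r iP ir cp e; apply: mx_sim_pair.
  have := map_mx_sim (@fst R R') e; rewrite !map_mx_dsum.
  by apply: cR; [apply: map_mx_idem..|apply: map_mx_compl].
have := map_mx_sim (@snd R R') e; rewrite !map_mx_dsum.
by apply: cR'; [apply: map_mx_idem..|apply: map_mx_compl].
Qed.

End PairMatrix.

(** * Cancellation over matrix semirings *)

Section FlattenMatrix.

Variables (R : nzSemiRingType) (n' : nat).
Local Notation n := n'.+1.

(** The Morita identification of matrices over M_n(R) with larger matrices over R; a flat index is
    decoded into its pair by inverting [mxvec_index]. *)
Definition flat_mx a b (X : 'M['M[R]_n]_(a, b)) : 'M[R]_(a * n, b * n) :=
  \matrix_(i, j) let u := enum_val (cast_ord (esym (mxvec_cast a n)) i) in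
                 let v := enum_val (cast_ord (esym (mxvec_cast b n)) j) in
                 X u.1 v.1 u.2 v.2.

Lemma flat_mxE a b (X : 'M['M[R]_n]_(a, b)) i s j t :
  flat_mx X (mxvec_index i s) (mxvec_index j t) = X i j s t.
Proof. by rewrite !mxE /mxvec_index !cast_ordK !enum_rankK. Qed.

Lemma flat_mxP a b (X Y : 'M[R]_(a * n, b * n)) :
  (forall i s j t, X (mxvec_index i s) (mxvec_index j t)
                 = Y (mxvec_index i s) (mxvec_index j t)) -> X = Y.
Proof.
move=> e; apply/matrixP=> i j.
by case/mxvec_indexP: i => i s; case/mxvec_indexP: j => j t.
Qed.

Definition unflat_mx a b (X : 'M[R]_(a * n, b * n)) : 'M['M[R]_n]_(a, b) :=
  \matrix_(i, j) \matrix_(s, t) X (mxvec_index i s) (mxvec_index j t).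

Lemma unflat_mxK a b : cancel (@unflat_mx a b) (@flat_mx a b).
Proof. by move=> X; apply: flat_mxP => i s j t; rewrite flat_mxE !mxE. Qed.

Lemma flat_mxK a b : cancel (@flat_mx a b) (@unflat_mx a b).
Proof.
by move=> X; apply/matrixP=> i j; apply/matrixP=> s t; rewrite 2!mxE flat_mxE.
Qed.

Lemma flat_mxM a b c (X : 'M['M[R]_n]_(a, b)) (Y : 'M_(b, c)) :
  flat_mx (X *m Y) = flat_mx X *m flat_mx Y.
Proof.
apply: flat_mxP => i s j t; rewrite flat_mxE mxE summxE [RHS]mxE.
pose h u v := flat_mx X (mxvec_index i s) (mxvec_index u v) *
              flat_mx Y (mxvec_index u v) (mxvec_index j t).
rewrite (reindex _ (curry_mxvec_bij _ _)) /=.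
rewrite (eq_bigr (fun w => h w.1 w.2)) => [|[u v] //].
rewrite -(pair_bigA _ h); apply: eq_bigr => u _.
by rewrite mxE; apply: eq_bigr => v _; rewrite /h !flat_mxE.
Qed.

Lemma flat_mxD a b (X Y : 'M['M[R]_n]_(a, b)) :
  flat_mx (X + Y) = flat_mx X + flat_mx Y.
Proof. by apply: flat_mxP => i s j t; rewrite [RHS]mxE !flat_mxE !mxE. Qed.

Lemma flat_mx0 a b : flat_mx (0 : 'M['M[R]_n]_(a, b)) = 0.
Proof. by apply: flat_mxP => i s j t; rewrite flat_mxE !mxE. Qed.

(** Uniqueness of the identity: the flattened [1] times the flattening of [unflat_mx 1] is evaluated
    in two ways, and no entry is computed. *)
Lemma flat_mx1 a : flat_mx (1%:M : 'M['M[R]_n]_a) = 1%:M.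
Proof.
rewrite -[LHS]mulmx1 -[X in _ *m X](@unflat_mxK a a) -flat_mxM mul1mx.
exact: unflat_mxK.
Qed.

Lemma mx_cancel_matrix : mx_cancel R -> mx_cancel 'M[R]_n.
Proof.
move=> cR a b c P p r iP ir [q [pq qp e]].
case/mx_sim_dsum_blocks=> x1 [x2 [x3 [x4 [y1 [y2 [y3 [y4 [eqx eqy]]]]]]]].
have : mx_sim (flat_mx P) (flat_mx p).
  apply: (cR _ _ _ _ _ (flat_mx r)).
  - by rewrite /mx_idem -flat_mxM iP.
  - by rewrite /mx_idem -flat_mxM ir.
  - by exists (flat_mx q); rewrite -!flat_mxM -flat_mxD pq qp e flat_mx0 flat_mx1.
  apply/mx_sim_dsum_blocks.
  exists (flat_mx x1), (flat_mx x2), (flat_mx x3), (flat_mx x4).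
  exists (flat_mx y1), (flat_mx y2), (flat_mx y3), (flat_mx y4).
  rewrite -!flat_mxM -!flat_mxD.
  by case: eqx => -> -> -> ->; case: eqy => -> -> -> ->; rewrite !flat_mx0.
case=> x [y [exy eyx]]; exists (unflat_mx x), (unflat_mx y).
by split; apply: (can_inj (@flat_mxK _ _)); rewrite flat_mxM !unflat_mxK.
Qed.

End FlattenMatrix.

(** * Diagonal 0-1 matrices *)

Definition set_mx (R : nzSemiRingType) n (D : {set 'I_n}) : 'M[R]_n :=
  \matrix_(i, j) ((i == j) && (i \in D))%:R.

Section SetMatrix.

Variables (R : nzSemiRingType) (n : nat).
Implicit Types D : {set 'I_n}.

Lemma set_mx0 : set_mx R (set0 : {set 'I_n}) = 0.
Proof. by apply/matrixP=> i j; rewrite !mxE inE andbF. Qed.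

Lemma set_mx_idem D : mx_idem (set_mx R D).
Proof.
apply/matrixP=> i j; rewrite mxE (bigD1 i) //= big1 => [|k ki].
  rewrite addr0 !mxE eqxx /=; case: (i \in D); last by rewrite mul0r andbF.
  by rewrite mul1r.
by rewrite mxE eq_sym (negbTE ki) mul0r.
Qed.

Lemma set_mx_delta m D i (j : 'I_m) :
  i \notin D -> set_mx R D *m delta_mx i j = 0.
Proof.
move=> iD; apply/matrixP=> a b; rewrite !mxE big1 // => k _; rewrite !mxE.
by case: eqVneq => [->|]; rewrite ?mul0r //=; case: eqVneq => [->|_];
   rewrite ?mulr0 //= (negbTE iD) mul0r.
Qed.

Lemma delta_set_mx m D i (j : 'I_m) :
  i \notin D -> delta_mx j i *m set_mx R D = 0.
Proof.
move=> iD; apply/matrixP=> a b; rewrite !mxE big1 // => k _; rewrite !mxE.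
case: (eqVneq k i) => [->|]; last by rewrite andbF mul0r.
by rewrite (negbTE iD) andbF mulr0.
Qed.

Lemma set_mxD1 D i :
  i \in D -> set_mx R D = set_mx R (D :\ i) + delta_mx i i.
Proof.
move=> iD; apply/matrixP=> a b; rewrite !mxE !inE.
case: (eqVneq a b) => [<-|ab] /=; last first.
  by rewrite add0r; case: eqVneq => //= <-; rewrite eq_sym (negbTE ab).
rewrite andbb; case: (eqVneq a i) => [->|_] /=; last by rewrite addr0.
by rewrite iD add0r.
Qed.

End SetMatrix.

(** * Cancellation over zerosumfree semirings without zero divisors *)

Section Zerosumfree.

Variable F : nzSemiRingType.
Hypothesis zsf : forall a b : F, a + b = 0 -> a = 0.
Hypothesis entire : forall a b : F, a * b = 0 -> a = 0 \/ b = 0.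

Lemma zsf_sum0 (I : finType) (f : I -> F) :
  \sum_i f i = 0 -> forall i, f i = 0.
Proof. by move=> + i; rewrite (bigD1 i) //= => /zsf. Qed.

Lemma zsf_addmx0 m n (X Y : 'M[F]_(m, n)) : X + Y = 0 -> X = 0 /\ Y = 0.
Proof.
move=> e; split; apply/matrixP=> i j; move/matrixP/(_ i j): e; rewrite !mxE.
  exact: zsf.
by rewrite addrC; exact: zsf.
Qed.

Lemma zsf_mulmx0 m n k (X : 'M[F]_(m, n)) (Y : 'M[F]_(n, k)) :
  X *m Y = 0 -> forall i j l, X i j * Y j l = 0.
Proof. by move=> e i j l; move/matrixP/(_ i l): e; rewrite !mxE => /zsf_sum0. Qed.

Lemma zsf_outer0 m n (x : 'cV[F]_m) (y : 'rV[F]_n) :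
  x *m y = 0 -> x = 0 \/ y = 0.
Proof.
move=> /zsf_mulmx0 e; have [->|/eqP x0] := eqVneq x 0; [by left|right].
have [i xi] : exists i, x i 0 != 0.
  apply: contra_notP x0 => /forallNP h; apply/matrixP=> i j.
  by rewrite ord1 mxE; apply/eqP; have /negP := h i; rewrite negbK.
apply/matrixP=> a j; rewrite ord1 [RHS]mxE.
by case: (entire (e i 0 j)) => // /eqP; rewrite (negbTE xi).
Qed.

(** From p + q = 1 the off-diagonal entries of [p] vanish. From p q = 0 each product p_ii q_ii
    vanishes, so p_ii + q_ii = 1 leaves only 0 or 1 for p_ii. *)
Lemma zsf_compl n (p : 'M[F]_n) :
  mx_compl p -> exists D : {set 'I_n}, p = set_mx F D.
Proof.
case=> q [/zsf_mulmx0 pq _ e]; exists [set i | p i i != 0].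
apply/matrixP=> i j; move/matrixP/(_ i j): e; rewrite !mxE inE.
case: eqVneq => [<-|_] /= e; last exact: zsf e.
case: eqVneq => [//|/eqP pii]; case: (entire (pq i i i)) => // qii.
by move: e; rewrite qii addr0.
Qed.

(* If the images satisfy [P + r = r] then [r] contains arbitrarily many
   orthogonal copies of [P]: this is what [A s] and [B s] are. *)
Lemma zsf_sim_dsum0 m n k (P : 'M[F]_m) (r : 'M[F]_k) :
  mx_idem P -> mx_idem r -> mx_sim (mx_dsum P r) (mx_dsum (0 : 'M_n) r) ->
  P = 0.
Proof.
move=> iP ir.
have i0 : mx_idem (0 : 'M[F]_n) by rewrite /mx_idem mul0mx.
move=> /(mx_sim_normal (mx_dsum_idem iP ir) (mx_dsum_idem i0 ir)).
case=> X [Y []]; rewrite -(submxK X) -(submxK Y).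
move: (ulsubmx X) (ursubmx X) (dlsubmx X) (drsubmx X) => X1 X2 X3 X4.
move: (ulsubmx Y) (ursubmx Y) (dlsubmx Y) (drsubmx Y) => Y1 Y2 Y3 Y4.
rewrite /mx_dsum !mulmx_block !(mulmx0, mul0mx, add0r, addr0).
move=> eP _ _ /eq_block_mx[X10 X2r X30 X4r] [/eq_block_mx[Y10 Y20 rY3 rY4] _].
move: eP; rewrite -X10 -X30 !mul0mx !add0r => /eq_block_mx[eP X2Y4 X4Y3 er].
(* [X4] and [Y4] move [r] into itself, orthogonally to the copy of [P] given by [X2] and [Y3];
   iterating the move yields the copies. *)
pose A s := iter s (mulmx^~ X4) X2; pose B s := iter s (mulmx Y4) Y3.
have Ar s : A s *m r = A s by case: s => [|s] //=; rewrite -mulmxA X4r.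
have AB s t : A s.+1 *m B t.+1 = A s *m B t.
  by rewrite /= mulmxA -(mulmxA (A s)) er Ar.
have AA s : A s *m B s = P by elim: s => [|s <-]; [|exact: AB].
have A0 s t : s != t -> A s *m B t = 0.
  elim: s t => [|s IH] [|t] // st; last by rewrite AB IH.
    by rewrite /= mulmxA X2Y4 mul0mx.
  by rewrite /= -mulmxA X4Y3 mulmx0.
apply/matrixP=> i j; rewrite [RHS]mxE; apply/eqP; apply: contraT => Pij.
(* Pigeonhole: [k.+1] copies, each with a nonzero term through one of [k] middle indices. Two copies
   sharing an index would have a nonzero product. *)
have /choice[f fP] (s : 'I_k.+1) : exists c, A s i c * B s c j != 0.
  apply: contra_notP (negP Pij) => /forallNP h.
  rewrite -(AA s) mxE big1 // => c _; apply/eqP.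
  by have /negP := h c; rewrite negbK.
have : ~~ injectiveb f.
  apply/negP=> /injectiveP/leq_card; rewrite !card_ord.
  by rewrite ltnn.
case/injectivePn=> s [t st fst].
have := zsf_mulmx0 (A0 _ _ st) i (f s) j.
case/entire => e0; first by have := fP s; rewrite e0 mul0r eqxx.
by have := fP t; rewrite -fst e0 mulr0 eqxx.
Qed.

(** Induction on the size of [D] plus the number of nonzero diagonal entries of [r]. The basis
    vector of some [j] in [D] corresponds to a rank one piece of the sum of [P] and [r]. A piece in
    [P] is removed together with [j]; a piece in [r] is removed from [r], with [P] and [D]
    unchanged. *)
Lemma zsf_sim_set_mx m n k (P : 'M[F]_m) (r : 'M[F]_k) (D : {set 'I_n}) :
  mx_idem P -> mx_idem r ->
  mx_sim (mx_dsum P r) (mx_dsum (set_mx F D) r) -> mx_sim P (set_mx F D).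
Proof.
have [N] := ubnP (#|D| + #|[set i | r i i != 0]|).
elim: N => // N IH in D P r *; rewrite ltnS => leN iP ir sPD.
have [D0|[j jD]] := set_0Vmem D.
  move: sPD; rewrite D0 set_mx0 => /(zsf_sim_dsum0 iP ir) ->.
  by exists 0, 0; rewrite !mul0mx.
have iD' := set_mx_idem F (D :\ j); set D' := D :\ j in iD'.
have jD' : j \notin D' by rewrite !inE eqxx.
have cD : (#|D| = #|D'|.+1)%N by rewrite (cardsD1 j) jD.
have eD : set_mx F D = set_mx F D' + delta_mx j (0 : 'I_1) *m delta_mx 0 j.
  by rewrite mul_delta_mx; apply: set_mxD1.
have dd : delta_mx 0 j *m delta_mx j (0 : 'I_1) = 1%:M :> 'M[F]_1.
  by rewrite mul_delta_mx; apply/matrixP=> a b; rewrite !mxE !ord1.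
move: (set_mx_delta F (0 : 'I_1) jD') (delta_set_mx F (0 : 'I_1) jD').
move: (delta_mx j 0) (delta_mx 0 j) eD dd => d d' eD dd D'd dD'.
(* [E] and [E'] single out the chosen basis vector, and [g'] is what remains of [g] without it. *)
pose g := mx_dsum (set_mx F D) r; pose g' := mx_dsum (set_mx F D') r.
pose E : 'cV[F]_(n + k) := col_mx d 0; pose E' : 'rV[F]_(n + k) := row_mx d' 0.
have eg : g = g' + E *m E'.
  rewrite mul_col_row !(mulmx0, mul0mx) /g' /mx_dsum add_block_mx.
  by rewrite !addr0 -eD.
have g'E : g' *m E = 0.
  by rewrite /g' /mx_dsum mul_block_col !(mulmx0, mul0mx, addr0) D'd col_mx0.
have E'g' : E' *m g' = 0.
  by rewrite /g' /mx_dsum mul_row_block !(mulmx0, mul0mx, addr0) dD' row_mx0.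
have E'E : E' *m E = 1%:M by rewrite mul_row_col mulmx0 addr0.
have ig' : mx_idem g' by apply: mx_dsum_idem.
have gg' : g *m g' = g' by rewrite eg mulmxDl -mulmxA E'g' mulmx0 addr0.
have gE : g *m E = E by rewrite eg mulmxDl -mulmxA E'E mulmx1 g'E add0r.
have ie : mx_idem (mx_dsum P r) by apply: mx_dsum_idem.
have [X [Y [XY YX _ Xg _]]] :=
  mx_sim_normal ie (mx_dsum_idem (set_mx_idem F D) ir) sPD.
rewrite -/g in YX Xg.
(* The decomposition of [g] transported to the other side: [h] corresponds to [g'], and the rank one
   [x *m y] to the basis vector. *)
pose h := X *m g' *m Y; pose x := X *m E; pose y := E' *m Y.
have hg' : mx_sim h g'.
  exists (X *m g'), (g' *m Y); split; first by rewrite /h mulmxA -(mulmxA X) ig'.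
  by rewrite mulmxA -(mulmxA g') YX -mulmxA gg' ig'.
have ih : mx_idem h.
  rewrite /mx_idem /h !mulmxA -(mulmxA (X *m g') Y) YX -(mulmxA (X *m g') g).
  by rewrite gg' -(mulmxA X g') ig'.
have eh : mx_dsum P r = h + x *m y.
  rewrite -XY -{1}Xg eg mulmxDr mulmxDl; congr (_ + _).
  by rewrite /x /y !mulmxA.
have hx : h *m x = 0 by rewrite /h /x -!mulmxA (mulmxA Y) YX gE g'E mulmx0.
have E'g : E' *m g = E' by rewrite eg mulmxDr E'g' add0r mulmxA E'E mul1mx.
have yh : y *m h = 0 by rewrite /y /h !mulmxA -(mulmxA E') YX E'g E'g' mul0mx.
have yx : y *m x = 1%:M by rewrite /x /y mulmxA -(mulmxA E') YX E'g E'E.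
move: hg' ih eh hx yh yx.
rewrite -(submxK h) -(vsubmxK x) -(hsubmxK y).
move: (ulsubmx h) (ursubmx h) (dlsubmx h) (drsubmx h) => h1 h2 h3 h4.
move: (usubmx x) (dsubmx x) (lsubmx y) (rsubmx y) => {h X Y XY YX Xg x y}.
move=> x1 x2 y1 y2 hg' ih.
rewrite mul_col_row add_block_mx.
(* The off-diagonal blocks of [mx_dsum P r] vanish, hence so do their summands: [h] is block
   diagonal and the cross terms of [x *m y] are zero. *)
move=> /eq_block_mx[eP /esym/zsf_addmx0[h20 xy12] /esym/zsf_addmx0[h30 xy21] er].
move: hg' ih; rewrite h20 h30 => hg' ih.
rewrite mul_block_col mul_row_block !(mulmx0, mul0mx, addr0, add0r).
rewrite -col_mx0 -row_mx0 => /eq_col_mx[hx1 hx2] /eq_row_mx[yh1 yh2].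
rewrite mul_row_col => yx.
move: ih; rewrite /mx_idem mulmx_block !(mulmx0, mul0mx, addr0, add0r).
move=> /eq_block_mx[ih1 _ _ ih4].
have one_neq0 : 1%:M <> 0 :> 'M[F]_1.
  by move/matrixP/(_ 0 0)/eqP; rewrite !mxE oner_eq0.
(* Each vanishing cross term kills one of its factors. Losing all of [x] or all of [y] would
   contradict y x = 1. *)
case: (zsf_outer0 xy12) => [x10|y20]; case: (zsf_outer0 xy21) => [x20|y10].
- by case: one_neq0; rewrite -yx x10 x20 !mulmx0 addr0.
- (* The new summand lies in the image of [r]. *)
  have {er} er : r = h4 + x2 *m y2 by [].
  have {eP} eP : P = h1 by rewrite eP x10 mul0mx addr0.
  have y2x2 : y2 *m x2 = 1%:M by rewrite -yx x10 mulmx0 add0r.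
  apply: (IH D P h4) => //; last first.
    rewrite {1}eP; apply: mx_sim_trans hg' _.
    - by rewrite -/(mx_dsum h1 h4); apply: mx_dsum_idem.
    - by apply: mx_dsum_idem => //; exact: set_mx_idem.
    (* The piece [x2 *m y2] of [r] crosses over and becomes the vector [d] missing from [D']. *)
    exists (block_mx (set_mx F D') 0 (x2 *m d') h4).
    exists (block_mx (set_mx F D') (d *m y2) 0 h4).
    rewrite /g' /mx_dsum !mulmx_block !(mulmx0, mul0mx, addr0, add0r).
    rewrite !mulmxA -(mulmxA d) y2x2 mulmx1 -(mulmxA d) yh2 mulmx0 hx2.
    rewrite !mul0mx -(mulmxA x2) dD' mulmx0 -(mulmxA x2 d') dd mulmx1.
    by rewrite D'd mul0mx ih4 iD' -eD addrC -er.
  apply: leq_trans leN; rewrite ltn_add2l; apply: proper_card.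
  rewrite properE; apply/andP; split.
    apply/subsetP=> i; rewrite !inE; apply: contra => /eqP rii.
    by apply/eqP; apply: (@zsf _ ((x2 *m y2) i i)); rewrite -rii er [RHS]mxE.
  (* The measure drops at an index where neither [y2] nor [x2] vanishes: there [r] has a nonzero
     diagonal entry, while h4 x2 = 0 forces that of [h4] to be zero. *)
  have [i yxi] : exists i, y2 0 i * x2 i 0 != 0.
    apply: contra_notP one_neq0 => /forallNP h0; rewrite -y2x2.
    apply/matrixP=> a b; rewrite !mxE !ord1 big1 // => i _; apply/eqP.
    by have /negP := h0 i; rewrite negbK.
  apply/subsetPn; exists i; rewrite !inE.
    apply: contra yxi => /eqP; rewrite er mxE addrC => /zsf.
    rewrite mxE big_ord1 => /entire[] ->; by rewrite ?mulr0 ?mul0r.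
  rewrite negbK; apply/eqP; case: (entire (zsf_mulmx0 hx2 i i 0)) => // xi0.
  by case/eqP: yxi; rewrite xi0 mulr0.
- (* The new summand lies in the image of [P]. *)
  have {er} er : h4 = r by rewrite er x20 mul0mx addr0.
  have y1x1 : y1 *m x1 = 1%:M by rewrite -yx x20 mulmx0 addr0.
  rewrite er in hg'.
  have [|u [v [uv vu hu uD [Dv vh]]]] :=
    mx_sim_normal ih1 iD' (IH D' h1 r _ ih1 ir hg').
    by apply: leq_trans leN; rewrite cD.
  have ud : u *m d = 0 by rewrite -uD -mulmxA D'd mulmx0.
  have dv : d' *m v = 0 by rewrite -Dv mulmxA dD' mul0mx.
  have vx : v *m x1 = 0 by rewrite -vh -mulmxA hx1 mulmx0.
  have yu : y1 *m u = 0 by rewrite -hu mulmxA yh1 mul0mx.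
  (* The equivalence between [h1] and [D'] is extended by matching the vector [d] with [x1]. *)
  exists (u + x1 *m d'), (v + d *m y1).
  rewrite !mulmxDl !mulmxDr uv vu !mulmxA ud vx -!(mulmxA _ d' _) dv.
  rewrite -!(mulmxA _ y1 _) yu y1x1 dd !(mulmx0, mul0mx, mulmx1, addr0, add0r).
  by rewrite -eP -eD.
by case: one_neq0; rewrite -yx y10 y20 !mul0mx addr0.
Qed.

Lemma zsf_cancel : mx_cancel F.
Proof.
move=> m n k P p r iP ir /zsf_compl[D ->]; exact: zsf_sim_set_mx.
Qed.

End Zerosumfree.

(** * Cancellation over a field *)

Section FieldIdempotents.

Variable K : fieldType.

(** In the factorization e = L p U with [p] a partial identity and [L], [U] invertible, idempotence
    reduces to p U L p = p. So L p and p U are witnesses. *)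
Lemma field_sim_pid n (e : 'M[K]_n) :
  mx_idem e -> mx_sim e (pid_mx (\rank e) : 'M_n).
Proof.
move=> ie; exists (col_ebase e *m pid_mx (\rank e)), (pid_mx (\rank e) *m row_ebase e).
have pp : (pid_mx (\rank e) : 'M[K]_n) *m pid_mx (\rank e) = pid_mx (\rank e) :> 'M_n.
  by rewrite pid_mx_id // rank_leq_row.
split; first by rewrite !mulmxA -(mulmxA (col_ebase e)) pp mulmx_ebase.
move: (mulmx_ebase e) (col_ebase_unit e) (row_ebase_unit e) pp ie.
move: (col_ebase e) (row_ebase e) (pid_mx _) => L U p /esym eE Lu Uu pp.
rewrite /mx_idem eE => /(congr1 (fun X => invmx L *m X *m invmx U)).
by rewrite !mulmxA (mulVmx Lu) mul1mx -!mulmxA (mulmxV Uu) !mulmx1 !mulmxA.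
Qed.

Lemma mx_sim_rank m n (e : 'M[K]_m) (f : 'M[K]_n) :
  mx_idem e -> mx_idem f -> mx_sim e f -> \rank e = \rank f.
Proof.
move=> ie iF [x [y [xy yx]]]; apply/eqP; rewrite eqn_leq; apply/andP; split.
  rewrite -ie -xy mulmxA -(mulmxA x) yx.
  exact: leq_trans (mxrankM_maxl _ _) (mxrankM_maxr _ _).
rewrite -iF -yx mulmxA -(mulmxA y) xy.
exact: leq_trans (mxrankM_maxl _ _) (mxrankM_maxr _ _).
Qed.

Lemma field_cancel : mx_cancel K.
Proof.
move=> m n k P p r iP ir /mx_compl_idem ip e.
have := mx_sim_rank (mx_dsum_idem iP ir) (mx_dsum_idem ip ir) e.
rewrite !rank_diag_block_mx => /addIn eqr.
apply: (mx_sim_trans iP ip (field_sim_pid iP)).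
have ipid : mx_idem (pid_mx (\rank p) : 'M[K]_m).
  by rewrite /mx_idem pid_mx_id // -eqr rank_leq_row.
rewrite eqr; apply: (mx_sim_trans ipid ip _ (mx_sim_sym (field_sim_pid ip))).
exists (pid_mx (\rank p)), (pid_mx (\rank p)).
by rewrite !pid_mx_id ?rank_leq_row // -eqr rank_leq_row.
Qed.

Lemma field_compl n (p : 'M[K]_n) :
  mx_compl p -> exists D : {set 'I_n}, mx_sim p (set_mx K D).
Proof.
move=> /mx_compl_idem/field_sim_pid e; exists [set i : 'I_n | (i < \rank p)%N].
suff -> : set_mx K [set i : 'I_n | (i < \rank p)%N] = pid_mx (\rank p) by [].
by apply/matrixP=> i j; rewrite !mxE inE.
Qed.

End FieldIdempotents.

(* Destructing [F] is what makes the final equation hold by conversion. *)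
Lemma comNzSemiRing_field (F : comNzSemiRingType) (opp inv : F -> F) :
  left_inverse 0 opp +%R -> (forall x, x != 0 -> inv x * x = 1) -> inv 0 = 0 ->
  exists K : fieldType, (K : comNzSemiRingType) = F.
Proof.
case: F opp inv => T cT; set F := GRing.ComNzSemiRing.Pack cT => opp inv.
move=> addN mulV inv0; pose zM := GRing.Nmodule_isZmodule.Build F addN.
pose Z : comNzRingType := HB.pack F zM.
pose fM := GRing.ComNzRing_isField.Build Z mulV inv0.
by exists (HB.pack Z fM : fieldType).
Qed.

(** Here [z] acts as minus one: multiplication by it is the negation, and inverses are those of the
    semifield. *)
Lemma semifield_field (F : comNzSemiRingType) (hF : semifield F) (z : F) :
  1 + z = 0 -> exists K : fieldType, (K : comNzSemiRingType) = F.
Proof.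
move=> z1.
have /choice[inv invP] (x : F) :
    exists y, if x == 0 then y = 0 else y * x = 1.
  have [_|/hF[y _ xy]] := eqVneq x 0; first by exists 0.
  by exists y; rewrite mulrC.
apply: (@comNzSemiRing_field F ( *%R z) inv).
- by move=> x; rewrite -{2}[x]mul1r -mulrDl addrC z1 mul0r.
- by move=> x /negbTE x0; have := invP x; rewrite x0.
- by have := invP 0; rewrite eqxx.
Qed.

(** * Semifields: the field case and the zerosumfree case combined *)

Section Semifield.

Variable F : comNzSemiRingType.
Hypothesis hF : semifield F.

Lemma semifield_entire (a b : F) : a * b = 0 -> a = 0 \/ b = 0.
Proof.
move=> ab; have [->|/hF[c _ ac]] := eqVneq a 0; [by left|right].
by rewrite -[b]mul1r -ac (mulrC a) -mulrA ab mulr0.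
Qed.

(** If [a] were nonzero, dividing a + b = 0 by it would make b / a an additive inverse of 1. *)
Lemma semifield_zsf (a b : F) :
  (forall z : F, 1 + z <> 0) -> a + b = 0 -> a = 0.
Proof.
move=> noN ab; have [//|a0] := eqVneq a 0; have [c _ ac] := hF a0.
by case: (noN (b * c)); rewrite -ac -mulrDl ab mul0r.
Qed.

Lemma semifield_cancel : mx_cancel F.
Proof.
have [[z /(semifield_field hF)[K eK]]|/forallNP noN] := pselect (exists z : F, 1 + z = 0).
  by case: _ / eK; exact: field_cancel.
by apply: zsf_cancel semifield_entire => a b; exact: semifield_zsf.
Qed.

Lemma semifield_compl n (p : 'M[F]_n) :
  mx_compl p -> exists D : {set 'I_n}, mx_sim p (set_mx F D).
Proof.
move=> cp.
have [[z /(semifield_field hF)[K eK]]|/forallNP noN] := pselect (exists z : F, 1 + z = 0).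
  by case: _ / eK p cp => p cp; exact: field_compl.
have zsf a b := @semifield_zsf a b noN.
have [D ->] := zsf_compl zsf semifield_entire cp.
by exists D; apply: mx_sim_refl; apply: set_mx_idem.
Qed.

End Semifield.

(** * Classes of idempotent matrices in K_0 *)

Section ImageModule.

Variables (R : nzSemiRingType) (m : nat) (e : 'M[R]_m).

(** For an idempotent [e] this is its row space; as a fixed-point condition it is decidable and
    visibly closed under linear operations. *)
Definition mx_fixed : {pred 'rV[R]_m} := [pred v | v *m e == v].

Lemma mx_fixed_closed : GRing.subsemimod_closed mx_fixed.
Proof.
split=> [|a v]; last first.
  by rewrite !inE => /eqP ev; rewrite -scalemxAl ev.
split; first by rewrite inE mul0mx.
by move=> u v; rewrite !inE => /eqP eu /eqP ev; rewrite mulmxDl eu ev.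
Qed.

HB.instance Definition _ :=
  GRing.isSubSemiModClosed.Build R 'rV[R]_m mx_fixed mx_fixed_closed.

Record mx_image := MxImage { mx_image_val : 'rV[R]_m; _ : mx_image_val \in mx_fixed }.

HB.instance Definition _ := [isSub for mx_image_val].
HB.instance Definition _ := [Choice of mx_image by <:].
HB.instance Definition _ := [SubChoice_isSubLSemiModule of mx_image by <:].

End ImageModule.

Section MatrixClass.

Variable S : nzSemiRingType.
Implicit Types P Q : rSemiModType S.

(* Elements of S^n are rows over [S^c], hence the transpose: the column space
   of [e] is [P]. *)
Definition mx_rep P m (e : 'M[S]_m) : Prop :=
  exists (f : {linear 'rV[S^c]_m -> P}) (g : {linear P -> 'rV[S^c]_m}),
    cancel g f /\ forall v, g (f v) = v *m (e^T : 'M[S^c]_m).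

(** Transposing reverses the factors, and the converse multiplication reverses the products of
    entries to match, so the identity holds over any semiring. *)
Lemma trmxM_rev m n k (X : 'M[S]_(m, n)) (Y : 'M[S]_(n, k)) :
  (Y^T : 'M[S^c]_(k, n)) *m (X^T : 'M[S^c]_(n, m)) = ((X *m Y)^T : 'M[S^c]_(k, m)).
Proof. by rewrite trmx_mul_rev. Qed.

Lemma mx_eq_rV m n (X Y : 'M[S^c]_(m, n)) :
  (forall v : 'rV_m, v *m X = v *m Y) -> X = Y.
Proof. by move=> e; apply/row_matrixP=> i; rewrite !rowE. Qed.

Lemma linear_mx m n (h : {linear 'rV[S^c]_m -> 'rV[S^c]_n}) :
  exists X : 'M[S]_(n, m), forall v, h v = v *m (X^T : 'M[S^c]_(m, n)).
Proof. by exists (lin1_mx h)^T => v; rewrite trmxK mul_rV_lin1. Qed.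

Lemma mx_rep_idem P m (e : 'M[S]_m) : mx_rep P e -> mx_idem e.
Proof.
case=> f [g [gK fE]]; apply: trmx_inj; rewrite -trmxM_rev.
by apply: mx_eq_rV => v; rewrite mulmxA -!fE gK.
Qed.

Lemma fgproj_rep P : is_fgproj P -> exists m (e : 'M[S]_m), mx_rep P e.
Proof.
case=> m [f [g gK]]; have [e eE] := linear_mx (g \o f).
by exists m, e, f, g; split=> // v; rewrite -eE.
Qed.

Lemma mx_rep_fgproj P m (e : 'M[S]_m) : mx_rep P e -> is_fgproj P.
Proof. by case=> f [g [gK _]]; exists m, f, g. Qed.

Lemma mx_idem_rep m (e : 'M[S]_m) :
  mx_idem e -> exists P : rSemiModType S, mx_rep P e.
Proof.
move=> ie; pose eT : 'M[S^c]_m := e^T; exists (mx_image eT).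
have fP (v : 'rV[S^c]_m) : v *m eT \in mx_fixed eT.
  by rewrite inE -mulmxA trmxM_rev ie.
have [f fE] : exists f : {linear 'rV[S^c]_m -> mx_image eT},
    forall v, val (f v) = v *m eT.
  have [|f fE] := @linear_pack S 'rV[S^c]_m (mx_image eT) (fun v => MxImage (fP v)).
    split=> [a v | u v]; apply: val_inj; rewrite /=.
      by rewrite scalemxAl.
    by rewrite mulmxDl.
  by exists f => v; rewrite fE.
have [g gE] : exists g : {linear mx_image eT -> 'rV[S^c]_m},
    forall x, g x = val x.
  by apply: linear_pack; split.
exists f, g; split=> [x | v]; last by rewrite gE fE.
by apply: val_inj; rewrite fE gE; apply/eqP; exact: (valP x).
Qed.

Lemma mx_sim_iso P Q m n (e : 'M[S]_m) (e' : 'M[S]_n) :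
  mx_rep P e -> mx_rep Q e' -> mx_sim e e' -> smod_iso P Q.
Proof.
move=> rP rQ; have ie := mx_rep_idem rP; have ie' := mx_rep_idem rQ.
case: rP rQ => f [g [gK fE]] [f' [g' [gK' fE']]].
move=> /(mx_sim_normal ie ie')[x [y [xy yx ex xe [ey ye]]]].
apply: (@smod_isoP S P Q (fun p => f' (g p *m (y^T : 'M[S^c]_(m, n))))
                         (fun q => f (g' q *m (x^T : 'M[S^c]_(n, m))))).
- by split=> [a p | p q]; rewrite ?linearZ ?linearD /= -?scalemxAl ?mulmxDl
                                  ?linearZ ?linearD.
- move=> p; rewrite fE' -!mulmxA !trmxM_rev xe xy.
  by rewrite -fE !gK.
- move=> q; rewrite fE -!mulmxA !trmxM_rev ye yx.
  by rewrite -fE' !gK'.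
Qed.

Lemma iso_mx_sim P Q m n (e : 'M[S]_m) (e' : 'M[S]_n) :
  mx_rep P e -> mx_rep Q e' -> smod_iso P Q -> mx_sim e e'.
Proof.
move=> [f [g [gK fE]]] [f' [g' [gK' fE']]] PQ.
case: (PQ) (smod_iso_sym PQ) => h [h' hK hK'] _.
have [k kE] : exists k : {linear Q -> P}, k =1 h'.
  by apply: linear_pack; apply: can2_semilinear hK hK'.
have [x xE] := linear_mx (g \o (k \o f')).
have [y yE] := linear_mx (g' \o (h \o f)).
exists x, y; split; apply: trmx_inj; apply: mx_eq_rV => v.
  by rewrite -trmxM_rev mulmxA -yE -xE /= gK' kE hK fE.
by rewrite -trmxM_rev mulmxA -xE -yE /= gK kE hK' fE'.
Qed.

Lemma mx_rep_dsum P Q m n (e : 'M[S]_m) (e' : 'M[S]_n) :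
  mx_rep P e -> mx_rep Q e' -> mx_rep (P * Q)%type (mx_dsum e e').
Proof.
move=> [f [g [gK fE]]] [f' [g' [gK' fE']]].
have [h hE] : exists h : {linear 'rV[S^c]_(m + n) -> (P * Q)%type},
    forall v, h v = (f (lsubmx v), f' (rsubmx v)).
  by apply: linear_pack; split=> [a v | u v];
    rewrite !(linearZ, linearD, raddfD) //=.
have [k kE] : exists k : {linear (P * Q)%type -> 'rV[S^c]_(m + n)},
    forall x, k x = row_mx (g x.1) (g' x.2).
  by apply: linear_pack; split=> [a v | u v];
    rewrite /= !(linearZ, linearD) ?scale_row_mx ?add_row_mx.
exists h, k; split=> [[x y] | v].
  by rewrite hE kE row_mxKl row_mxKr gK gK'.
rewrite kE hE /= fE fE' /mx_dsum (tr_block_mx e 0 0 e') !trmx0.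
by rewrite -{3}(hsubmxK v) mul_row_block !mulmx0 addr0 add0r.
Qed.

Lemma mx_rep_regular : mx_rep (S^c^o : rSemiModType S) (1%:M : 'M[S]_1).
Proof.
have [f fE] : exists f : {linear 'rV[S^c]_1 -> S^c^o}, forall v, f v = v 0 0.
  by apply: linear_pack; split=> [a v | u v]; rewrite !mxE.
have [g gE] : exists g : {linear S^c^o -> 'rV[S^c]_1},
    forall x, g x = const_mx x.
  by apply: linear_pack; split=> [a v | u v]; apply/matrixP => i j; rewrite !mxE.
exists f, g; split=> [x | v]; first by rewrite gE fE mxE.
rewrite gE fE (trmx1 S) (mulmx1 v).
by apply/rowP=> i; rewrite !mxE ord1.
Qed.

(** Made total by a default: zero when [e] represents no projective, that is, when [e] is not
    idempotent. *)
Definition mx_class m (e : 'M[S]_m) : K0 S :=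
  if pselect (exists P : fgproj S, mx_rep P e) is left h
  then K0_class (sval (cid h)) else K0_zero S.

Lemma mx_classE (P : fgproj S) m (e : 'M[S]_m) :
  mx_rep P e -> mx_class e = K0_class P.
Proof.
move=> rP; rewrite /mx_class; case: pselect => [h|[]]; last by exists P.
case: cid => Q /= rQ; congr (groth_in _ _ _); apply/to_iso_class_eq.
exact: mx_sim_iso rQ rP (mx_sim_refl (mx_rep_idem rP)).
Qed.

Lemma mx_idem_fgproj m (e : 'M[S]_m) :
  mx_idem e -> exists P : fgproj S, mx_rep P e.
Proof.
by move=> /mx_idem_rep[P rP]; exists (FGProj (mx_rep_fgproj rP)).
Qed.

Lemma mx_class_sim m n (e : 'M[S]_m) (e' : 'M[S]_n) :
  mx_idem e -> mx_idem e' -> mx_sim e e' -> mx_class e = mx_class e'.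
Proof.
move=> /mx_idem_fgproj[P rP] /mx_idem_fgproj[Q rQ] ee.
rewrite (mx_classE rP) (mx_classE rQ); congr (groth_in _ _ _).
by apply/to_iso_class_eq; exact: mx_sim_iso ee.
Qed.

Lemma mx_class_dsum m n (e : 'M[S]_m) (e' : 'M[S]_n) :
  mx_idem e -> mx_idem e' ->
  mx_class (mx_dsum e e') = K0_add (mx_class e) (mx_class e').
Proof.
move=> /mx_idem_fgproj[P rP] /mx_idem_fgproj[Q rQ].
rewrite (mx_classE rP) (mx_classE rQ) -K0_classD; apply: mx_classE.
exact: mx_rep_dsum.
Qed.

Lemma mx_class_eq m n (e : 'M[S]_m) (e' : 'M[S]_n) :
  mx_idem e -> mx_idem e' -> mx_class e = mx_class e' ->
  exists k (r : 'M[S]_k), mx_idem r /\ mx_sim (mx_dsum e r) (mx_dsum e' r).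
Proof.
move=> /mx_idem_fgproj[P rP] /mx_idem_fgproj[Q rQ].
rewrite (mx_classE rP) (mx_classE rQ) => /K0_class_eq[R PQ].
have [k [r rR]] := fgproj_rep (fgprojP R).
exists k, r; split; first exact: mx_rep_idem rR.
by apply: iso_mx_sim PQ; apply: mx_rep_dsum.
Qed.

Lemma mx_class_pos m (e : 'M[S]_m) : mx_idem e -> K0_pos (mx_class e).
Proof. by move=> /mx_idem_fgproj[P rP]; exists P; exact: mx_classE. Qed.

Lemma K0_pos_mx (x : K0 S) :
  K0_pos x -> exists m (e : 'M[S]_m), mx_idem e /\ mx_class e = x.
Proof.
case=> P ->; have [m [e rP]] := fgproj_rep (fgprojP P).
by exists m, e; split; [exact: mx_rep_idem rP|exact: mx_classE].
Qed.

Lemma mx_class1 : mx_class (1%:M : 'M[S]_1) = K0_class (fgproj_regular S).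
Proof. exact: (@mx_classE (fgproj_regular S) 1 _ mx_rep_regular). Qed.

(** The way back from K_0 to matrices: equal classes provide some [r] to be added to both sides, and
    cancellation removes it. *)
Lemma mx_class_cancel m n (e : 'M[S]_m) (p : 'M[S]_n) :
  mx_cancel S -> mx_idem e -> mx_compl p -> mx_class e = mx_class p -> mx_sim e p.
Proof.
move=> cS ie cp /(mx_class_eq ie (mx_compl_idem cp))[k [r [ir]]].
exact: cS.
Qed.

End MatrixClass.

(** * Homomorphisms from matricial algebras *)

Section Elements.

Variable A : nzSemiRingType.
Implicit Types p q x y : A.

Definition el_compl p : Prop := exists q, [/\ p * q = 0, q * p = 0 & p + q = 1].

Definition el_orth p q : Prop := [/\ p * p = p, q * q = q, p * q = 0 & q * p = 0].

Definition el_class p : K0 A := mx_class (p%:M : 'M[A]_1).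

Lemma el_compl_idem p : el_compl p -> p * p = p.
Proof. by case=> q [pq _ e]; rewrite -{3}[p]mulr1 -e mulrDr pq addr0. Qed.

Lemma el_complC p q : p * q = 0 -> q * p = 0 -> p + q = 1 -> el_orth p q.
Proof.
move=> pq qp e; split=> //; first by apply: el_compl_idem; exists q.
by apply: el_compl_idem; exists p; rewrite addrC.
Qed.

Lemma el_orthC p q : el_orth p q -> el_orth q p.
Proof. by case. Qed.

Lemma el_orthD p q : el_orth p q -> (p + q) * (p + q) = p + q.
Proof. by case=> pp qq pq qp; rewrite mulrDl !mulrDr pp qq pq qp addr0 add0r. Qed.

Lemma el_compl1 : el_compl 1.
Proof. by exists 0; rewrite !(mulr0, mul0r, addr0). Qed.

(** If [r] complements [p + q], then [q + r] complements [p]: multiplying (p + q) r = 0 by [p] on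
    the left gives p r = 0, and symmetrically r p = 0. *)
Lemma el_compl_orth p q : el_orth p q -> el_compl (p + q) -> el_compl p.
Proof.
case=> pp qq pq qp [r [e1 e2 e3]]; exists (q + r).
have pr : p * r = 0.
  by have := congr1 ( *%R p) e1; rewrite /= mulr0 mulrA mulrDr pp pq addr0.
have rp : r * p = 0.
  have := congr1 ( *%R^~ p) e2.
  by rewrite /= mul0r -mulrA mulrDl pp qp addr0.
by rewrite mulrDr mulrDl pq qp pr rp !addr0 addrA e3.
Qed.

Lemma scalar_mx_idem p : p * p = p -> mx_idem (p%:M : 'M[A]_1).
Proof. by move=> pp; rewrite /mx_idem -scalar_mxM pp. Qed.

Lemma scalar_mx_compl p : el_compl p -> mx_compl (p%:M : 'M[A]_1).
Proof.
case=> q [pq qp e]; exists q%:M.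
by rewrite -!scalar_mxM -raddfD /= pq qp e raddf0.
Qed.

Lemma el_classM x y :
  (x * y) * (x * y) = x * y -> (y * x) * (y * x) = y * x ->
  el_class (x * y) = el_class (y * x).
Proof.
move=> /scalar_mx_idem ixy /scalar_mx_idem iyx; apply: mx_class_sim => //.
by exists x%:M, y%:M; rewrite -!scalar_mxM.
Qed.

Lemma el_classD p q :
  el_orth p q -> el_class (p + q) = K0_add (el_class p) (el_class q).
Proof.
move=> pqo; have [pp qq pq qp] := pqo.
have [ip iq] := (scalar_mx_idem pp, scalar_mx_idem qq).
rewrite -mx_class_dsum //; apply: mx_class_sim.
- by apply: scalar_mx_idem; exact: el_orthD.
- exact: mx_dsum_idem.
exists (row_mx p%:M q%:M), (col_mx p%:M q%:M).
rewrite mul_row_col mul_col_row -!scalar_mxM pp qq pq qp -raddfD.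
by rewrite /mx_dsum !raddf0.
Qed.

Lemma el_class_sim x p :
  mx_cancel A -> x * x = x -> el_compl p -> el_class x = el_class p ->
  exists y z, y * z = x /\ z * y = p.
Proof.
move=> cA /scalar_mx_idem ix /scalar_mx_compl cp.
case/(mx_class_cancel cA ix cp) => y [z [/matrixP/(_ 0 0) yz /matrixP/(_ 0 0) zy]].
by exists (y 0 0), (z 0 0); move: yz zy; rewrite !mxE !big_ord1.
Qed.

Lemma el_class_sim_normal x p :
  mx_cancel A -> x * x = x -> el_compl p -> el_class x = el_class p ->
  exists y z, [/\ y * z = x, z * y = p, x * y = y, z * x = z
    & y * p = y /\ p * z = z].
Proof.
move=> cA ix cp; have ip := el_compl_idem cp.
case/(el_class_sim cA ix cp) => y [z [yz zy]]; exists (x * y), (p * z).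
have xy : x * y = y * p by rewrite -yz -zy mulrA.
have pz : p * z = z * x by rewrite -yz -zy mulrA.
split.
- by rewrite {1}xy mulrA -(mulrA y) ip -mulrA pz mulrA yz ix.
- by rewrite {1}pz mulrA -(mulrA z) ix -mulrA xy mulrA zy ip.
- by rewrite mulrA ix.
- by rewrite pz -mulrA ix.
by rewrite mulrA ip; split=> //; rewrite xy -mulrA ip.
Qed.

(** The equivalence of [u] with the direct sum of [e] and [f] pulls the two summands back to
    [y1 *m x1] and [y2 *m x2], which are of size 1 whatever the sizes of [e] and [f]. *)
Lemma el_class_split u (a b : K0 A) :
  mx_cancel A -> el_compl u -> K0_pos a -> K0_pos b -> el_class u = K0_add a b ->
  exists p q, [/\ el_orth p q, p + q = u, el_class p = a & el_class q = b].
Proof.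
move=> cA cu /K0_pos_mx[m [e [ie <-]]] /K0_pos_mx[n [f [iF <-]]].
rewrite -mx_class_dsum // => /esym.
have ief := mx_dsum_idem ie iF.
have iu := scalar_mx_idem (el_compl_idem cu).
move/(mx_class_cancel cA ief (scalar_mx_compl cu)).
case/(mx_sim_normal ief iu) => X [Y []]; rewrite -(vsubmxK X) -(hsubmxK Y).
move: (usubmx X) (dsubmx X) (lsubmx Y) (rsubmx Y) => {X Y} x1 x2 y1 y2.
rewrite mul_col_row mul_row_col /mx_dsum mul_block_col !mul0mx addr0 add0r.
move=> /eq_block_mx[xy1 xy12 xy21 xy2] eu /eq_col_mx[ex1 fx2] _ _.
have E (M N : 'M[A]_1) : (M *m N) 0 0 = M 0 0 * N 0 0 by rewrite mxE big_ord1.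
have yx1 : (y1 *m x1) *m (y1 *m x1) = y1 *m x1.
  by rewrite -mulmxA (mulmxA x1) xy1 ex1.
have yx2 : (y2 *m x2) *m (y2 *m x2) = y2 *m x2.
  by rewrite -mulmxA (mulmxA x2) xy2 fx2.
exists ((y1 *m x1) 0 0), ((y2 *m x2) 0 0); split.
- split; rewrite -E ?yx1 ?yx2 //.
    by rewrite -mulmxA (mulmxA x1) xy12 mul0mx mulmx0 mxE.
  by rewrite -mulmxA (mulmxA x2) xy21 mul0mx mulmx0 mxE.
- by move/matrixP/(_ 0 0): eu; rewrite !mxE.
- rewrite /el_class -mx11_scalar; apply: mx_class_sim => //.
  by exists y1, x1.
rewrite /el_class -mx11_scalar; apply: mx_class_sim => //.
by exists y2, x2.
Qed.

End Elements.

(** * Class functions on idempotents and corner homomorphisms *)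

Lemma linear_exists (R : nzSemiRingType) (U V : lSemiModType R) (g : U -> V) :
  semilinear g -> exists gL : {linear U -> V}, gL =1 g.
Proof.
move=> lg; pose gM := GRing.isSemilinear.Build _ _ _ _ g lg.
by exists (HB.pack g gM : {linear U -> V}).
Qed.

(* The properties of [p |-> [h p]] for a homomorphism [h : B -> S] that are
   used to lift maps between K_0 groups to homomorphisms. *)
Definition k_functional (B S : nzSemiRingType) (g : B -> K0 S) : Prop :=
  [/\ forall p q, el_orth p q -> g (p + q) = K0_add (g p) (g q),
      forall x y, x * y * (x * y) = x * y -> y * x * (y * x) = y * x ->
        g (x * y) = g (y * x)
    & forall p, p * p = p -> K0_pos (g p)].

Lemma K0_idem0 (S : nzSemiRingType) (a : K0 S) : K0_add a a = a -> a = K0_zero S.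
Proof.
move=> aa; rewrite -(K0_add0 a) -{1}(K0_addN a) -K0_addA aa.
exact: K0_addN.
Qed.

Lemma k_functional0 (B S : nzSemiRingType) (g : B -> K0 S) :
  k_functional g -> g 0 = K0_zero S.
Proof.
case=> gD _ _; apply: K0_idem0; rewrite -gD ?addr0 //.
by split; rewrite mulr0.
Qed.

Section CornerHom.

Variable F : comNzSemiRingType.

(* A homomorphism onto a subalgebra whose identity is the idempotent [b 1]. *)
Definition corner_hom (B S : semiAlgType F) (b : {linear B -> S}) : Prop :=
  {morph b : x y / x * y}.

Lemma corner_orth (B S : semiAlgType F) (b : {linear B -> S}) p q :
  corner_hom b -> el_orth p q -> el_orth (b p) (b q).
Proof.
by move=> bM [pp qq pq qp]; split; rewrite -bM ?pp ?qq ?pq ?qp ?linear0.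
Qed.

Lemma corner_compl (B S : semiAlgType F) (b : {linear B -> S}) p :
  corner_hom b -> el_compl (b 1) -> el_compl p -> el_compl (b p).
Proof.
move=> bM c1 [q [pq qp e]].
apply: (@el_compl_orth _ _ (b q)); last by rewrite -linearD e.
by apply: corner_orth => //; exact: el_complC.
Qed.

Lemma corner_k_functional (B S : semiAlgType F) (b : {linear B -> S}) :
  corner_hom b -> k_functional (fun p => el_class (b p)).
Proof.
move=> bM; split=> [p q pq | x y xy yx | p pp].
- by rewrite linearD el_classD //; exact: corner_orth.
- by rewrite !bM; apply: el_classM; rewrite -!bM ?xy ?yx.
by apply: mx_class_pos; apply: scalar_mx_idem; rewrite -bM pp.
Qed.

End CornerHom.

(** * Matrix units and orthogonal splittings *)

Section MatrixUnits.

Variables (F : comNzSemiRingType) (n' : nat).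
Hypothesis hF : semifield F.
Local Notation n := n'.+1.
Local Notation E i j := (delta_mx i j : 'M[F]_n).

Lemma delta_mul (i j k l : 'I_n) : E i j * E k l = E i l *+ (j == k).
Proof. exact: mul_delta_mx_cond. Qed.

Lemma delta_idem i : E i i * E i i = E i i.
Proof. by rewrite delta_mul eqxx. Qed.

Lemma delta_orth i j : i != j -> el_orth (E i i) (E j j).
Proof.
by move=> /negbTE ij; split; rewrite delta_mul ?eqxx // ?ij // eq_sym ij.
Qed.

Lemma sum_delta : \sum_i E i i = 1.
Proof.
apply/matrixP=> i j; rewrite summxE (bigD1 i) //= big1 => [|k ki].
  by rewrite addr0 !mxE eqxx eq_sym.
by rewrite !mxE eq_sym (negbTE ki).
Qed.

Lemma delta_sandwich (c : 'M[F]_n) i j k l :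
  E i j * c * E k l = c j k *: E i l.
Proof.
rewrite {1}(matrix_sum_delta c) mulr_sumr mulr_suml (bigD1 j) //=.
rewrite [X in _ + X]big1 => [|s sj].
  rewrite addr0 mulr_sumr mulr_suml (bigD1 k) //= [X in _ + X]big1 => [|t tk].
    rewrite -scalerAr -scalerAl delta_mul eqxx delta_mul eqxx.
    by rewrite addr0.
  rewrite -scalerAr -scalerAl delta_mul eqxx delta_mul (negbTE tk).
  by rewrite scaler0.
rewrite mulr_sumr mulr_suml big1 // => t _.
by rewrite -scalerAr delta_mul eq_sym (negbTE sj) mulr0n scaler0 mul0r.
Qed.

Lemma k_functional_delta (S : nzSemiRingType) (g : 'M[F]_n -> K0 S) i :
  k_functional g -> g (E i i) = g (E 0 0).
Proof.
case=> _ gM _; have := gM (E i 0) (E 0 i).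
by rewrite !(delta_mul, eqxx, mulr1n); apply.
Qed.

(** A complemented idempotent is equivalent to a diagonal 0-1 matrix, an orthogonal sum of units
    [E i i] that all take the value at [E 0 0]. *)
Lemma k_functional_matrix (S : nzSemiRingType) (g h : 'M[F]_n -> K0 S) p :
  k_functional g -> k_functional h -> g (E 0 0) = h (E 0 0) ->
  el_compl p -> g p = h p.
Proof.
move=> kg kh gh cp; have [|D [x [y [xy yx]]]] := @semifield_compl F hF n p.
  by case: cp => q [pq qp e]; exists q.
have ip := el_compl_idem cp.
have [[gD gM _] [hD hM _]] := (kg, kh).
have iD := set_mx_idem F D; rewrite /mx_idem -yx in iD.
have {xy} xy : x * y = p by [].
rewrite -xy in ip *; rewrite (gM _ _ ip iD) (hM _ _ ip iD).
have -> : y * x = set_mx F D by [].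
have [m] := ubnP #|D|; elim: m => // m IH in D {x y xy yx ip iD} *; rewrite ltnS => leD.
have [->|[i iD]] := set_0Vmem D.
  by rewrite set_mx0 (k_functional0 kg) (k_functional0 kh).
have orth : el_orth (set_mx F (D :\ i)) (E i i).
  have iDi : i \notin D :\ i by rewrite !inE eqxx.
  split; [exact: set_mx_idem | exact: delta_idem | exact: set_mx_delta |].
  exact: delta_set_mx.
rewrite (set_mxD1 F iD) gD // hD // IH; last first.
  by apply: leq_trans leD; rewrite [leqRHS](cardsD1 i) iD.
by rewrite (k_functional_delta i kg) (k_functional_delta i kh) gh.
Qed.

(** [el_class_split] iterated. Each piece is complemented, being an orthogonal summand of a
    complemented idempotent, so the splitting can go on. *)
Lemma el_class_splits (S B : nzSemiRingType) (g : B -> K0 S) k (e : 'I_k -> B) u :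
  mx_cancel S -> k_functional g -> (forall i, e i * e i = e i) ->
  (forall i j, i != j -> e i * e j = 0) ->
  el_compl u -> el_class u = g (\sum_i e i) ->
  exists v : 'I_k -> S, [/\ \sum_i v i = u, forall i, v i * v i = v i,
    forall i j, i != j -> v i * v j = 0, forall i, el_compl (v i)
    & forall i, el_class (v i) = g (e i)].
Proof.
move=> cS kg; elim: k => [|k IH] in e u *.
  rewrite big_ord0 (k_functional0 kg) => _ _ cu u0.
  exists (fun i => u); split; try by case.
  rewrite big_ord0; apply/esym.
  (* A complemented idempotent of class zero vanishes: cancellation writes it as [z * y] with
     [y * z = 0], and it equals its square. *)
  have [||y [z [yz zy]]] := @el_class_sim _ 0 u cS _ cu.
  - by rewrite mulr0.
  - rewrite u0; apply: K0_idem0; rewrite -el_classD ?addr0 //.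
    by split; rewrite mulr0.
  by rewrite -(el_compl_idem cu) -zy -mulrA (mulrA y) yz mul0r mulr0.
move=> ee e0 cu; rewrite big_ord_recl.
have [gD _ gpos] := kg.
have s0 : el_orth (e ord0) (\sum_i e (lift ord0 i)).
  split=> //.
  - rewrite mulr_suml; apply: eq_bigr => i _; rewrite mulr_sumr (bigD1 i) //= ee.
    rewrite big1 ?addr0 // => j ji; rewrite e0 // eq_sym.
    by rewrite (inj_eq lift_inj).
  - by rewrite mulr_sumr big1 // => i _; rewrite e0 // neq_lift.
  - by rewrite mulr_suml big1 // => i _; rewrite e0 // eq_sym neq_lift.
rewrite gD // => cl.
have [v0 [v' [ov eu cl0 cl']]] :
    exists v0 v', [/\ el_orth v0 v', v0 + v' = u, el_class v0 = g (e ord0)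
                   & el_class v' = g (\sum_i e (lift ord0 i))].
  by apply: el_class_split => //; apply: gpos; case: s0.
have cv0 : el_compl v0 by apply: (el_compl_orth ov); rewrite eu.
have cv' : el_compl v'.
  by apply: (el_compl_orth (el_orthC ov)); rewrite addrC eu.
have [||||v [ev vv vo cv clv]] := IH (fun i => e (lift ord0 i)) v'.
- by move=> i.
- by move=> i j ij; rewrite e0 // (inj_eq lift_inj).
- by [].
- by [].
have [iv0 iv' v0v' v'v0] := ov.
have vE i : v' * v i = v i /\ v i * v' = v i.
  rewrite -ev mulr_suml mulr_sumr; split; rewrite (bigD1 i) //= vv big1 ?addr0 //.
    by move=> j ji; rewrite vo.
  by move=> j ji; rewrite vo // eq_sym.
exists (fun i => if unlift ord0 i is Some j then v j else v0); split.
- rewrite big_ord_recl unlift_none -eu -ev; congr (_ + _).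
  by apply: eq_bigr => i _; rewrite liftK.
- by move=> i; case: unliftP.
- move=> i j; case: unliftP => [a ->|->]; case: unliftP => [b ->|->] //.
  + by rewrite (inj_eq lift_inj); exact: vo.
  + by move=> _; rewrite -(vE a).2 -mulrA v'v0 mulr0.
  + by move=> _; rewrite -(vE b).1 mulrA v0v' mul0r.
- by move=> i; case: unliftP => [a _|_].
by move=> i; case: unliftP => [a ->|->].
Qed.

End MatrixUnits.

(** * Existence and conjugacy of lifts *)

Section Lifting.

Variable F : comNzSemiRingType.
Hypothesis hF : semifield F.

(** Stated for a function [g] on [B] and a corner [u] of [S] because both restrict to a factor of a
    product: [g] to c -> g (c, 0), and the unit of the factor to a part of [u]. *)
Definition lifts_exist (B : semiAlgType F) : Prop :=
  forall (S : semiAlgType F) (g : B -> K0 S) (u : S), mx_cancel S ->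
    k_functional g -> el_compl u -> el_class u = g 1 ->
    exists b : {linear B -> S}, [/\ corner_hom b, b 1 = u
      & forall p, el_compl p -> el_class (b p) = g p].

(** Between corners [x] and [y] need not be invertible in [S]; for unital maps the equations at
    [c = 1] make them mutually inverse. *)
Definition lifts_conj (B : semiAlgType F) : Prop :=
  forall (S : semiAlgType F) (b b' : {linear B -> S}), mx_cancel S ->
    corner_hom b -> corner_hom b' -> el_compl (b 1) -> el_compl (b' 1) ->
    (forall p, el_compl p -> el_class (b p) = el_class (b' p)) ->
    exists x y : S, forall c, x * b' c * y = b c /\ y * b c * x = b' c.

Section Matrix.

Variable n' : nat.
Local Notation n := n'.+1.
Local Notation E i j := (delta_mx i j : 'M[F]_n).

Lemma matrix_sum_scale (V : lSemiModType F) (b : {linear 'M[F]_n -> V}) c :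
  b c = \sum_i \sum_j c i j *: b (E i j).
Proof.
rewrite {1}(matrix_sum_delta c) linear_sum; apply: eq_bigr => i _.
by rewrite linear_sum; apply: eq_bigr => j _; rewrite linearZ.
Qed.

(** [u] splits into pieces [v i] of class g (E i i). These classes coincide, so [v i] is equivalent
    to [v 0] through [x i] and [y i], and the products [x i * y j] are matrix units whose diagonal
    sums to [u]. *)
Lemma matrix_lifts_exist : lifts_exist 'M[F]_n.
Proof.
move=> S g u cS kg cu; rewrite -[in g 1](sum_delta F n') => gu.
have [||v [ev vv vo cv clv]] := el_class_splits cS kg _ _ cu gu.
- exact: delta_idem.
- by move=> i j ij; case: (delta_orth F ij).
have /choice[xy xyP] (i : 'I_n) : exists xy : S * S,
    [/\ xy.1 * xy.2 = v i, xy.2 * xy.1 = v 0, v i * xy.1 = xy.1,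
        xy.2 * v i = xy.2 & xy.1 * v 0 = xy.1 /\ v 0 * xy.2 = xy.2].
  have [||y [z h]] := @el_class_sim_normal _ (v i) (v 0) cS _ (cv 0).
  - exact: vv.
  - by rewrite !clv; exact: k_functional_delta.
  by exists (y, z).
pose x i := (xy i).1; pose y i := (xy i).2.
have xyE i : x i * y i = v i by case: (xyP i).
have yxE i : y i * x i = v 0 by case: (xyP i).
have vx i : v i * x i = x i by case: (xyP i).
have yv i : y i * v i = y i by case: (xyP i).
have xv i : x i * v 0 = x i by case: (xyP i) => _ _ _ _ [].
have yx0 i j : i != j -> y i * x j = 0.
  by move=> ij; rewrite -yv -(vx j) mulrA -(mulrA (y i)) vo // mulr0 mul0r.
have [b bE] : exists b : {linear 'M[F]_n -> S},
    forall c, b c = \sum_i \sum_j c i j *: (x i * y j).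
  apply: linear_exists; split=> [a c | c d].
    rewrite scaler_sumr; apply: eq_bigr => i _; rewrite scaler_sumr.
    by apply: eq_bigr => j _; rewrite mxE scalerA.
  rewrite -big_split; apply: eq_bigr => i _; rewrite -big_split.
  by apply: eq_bigr => j _; rewrite mxE scalerDl.
have bD i j : b (E i j) = x i * y j.
  rewrite bE (bigD1 i) //= (bigD1 j) //= !big1 ?addr0.
  - by rewrite mxE !eqxx scale1r.
  - move=> k ki; rewrite big1 // => l _.
    by rewrite mxE (negbTE ki) scale0r.
  - by move=> k kj; rewrite mxE (negbTE kj) andbF scale0r.
have bM : corner_hom b.
  move=> c d; rewrite (bE (c * d)) (bE c) mulr_suml; apply: eq_bigr => i _.
  under [LHS]eq_bigr => j _.
    rewrite mxE scaler_suml; over.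
  rewrite /= exchange_big mulr_suml; apply: eq_bigr => k _ /=.
  rewrite bE mulr_sumr [RHS](bigD1 k) //= [X in _ = _ + X]big1 => [|l lk].
    rewrite addr0 mulr_sumr; apply: eq_bigr => j _.
    rewrite -scalerAl -scalerAr scalerA; congr (_ *: _).
    by rewrite !mulrA -(mulrA (x i)) yxE xv.
  rewrite mulr_sumr big1 // => j _; rewrite -scalerAl -scalerAr.
  by rewrite !mulrA -(mulrA (x i)) yx0 1?eq_sym // mulr0 mul0r !scaler0.
have b1 : b 1 = u.
  by rewrite -(sum_delta F n') linear_sum -ev; apply: eq_bigr => i _; rewrite bD xyE.
exists b; split=> // p cp.
apply: (k_functional_matrix hF (corner_k_functional bM) kg) => //.
by rewrite /= bD xyE clv.
Qed.

(** An equivalence between the two images of [E 0 0] is spread over the whole diagonal by the images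
    of the matrix units. *)
Lemma matrix_lifts_conj : lifts_conj 'M[F]_n.
Proof.
move=> S b b' cS bM b'M cb cb' bb'.
have cE0 : el_compl (E 0 0).
  apply: (@el_compl_orth _ _ (\sum_(i | i != 0) E i i)); last first.
    suff -> : E 0 0 + \sum_(i | i != 0) E i i = 1 by exact: el_compl1.
    by rewrite -(sum_delta F n') [RHS](bigD1 0).
  have o i j : i != j -> E i i * E j j = 0 by move=> ij; case: (delta_orth F ij).
  split; first exact: delta_idem.
  - rewrite mulr_suml; apply: eq_bigr => i i0.
    rewrite mulr_sumr (bigD1 i) //= delta_idem big1 ?addr0 // => j /andP[_ ji].
    by rewrite o // eq_sym.
  - by rewrite mulr_sumr big1 // => i i0; rewrite o // eq_sym.
  - by rewrite mulr_suml big1 // => i i0; rewrite o.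
have ib : b (E 0 0) * b (E 0 0) = b (E 0 0) by rewrite -bM delta_idem.
have [||x [y [xy yx bx yb [xb by_]]]] :=
  @el_class_sim_normal S (b (E 0 0)) (b' (E 0 0)) cS ib.
- exact: corner_compl.
- exact: bb'.
(* Stated for two arbitrary maps so that it yields both equations, with the roles of [b] and [b']
   exchanged. *)
have half (a a' : {linear 'M[F]_n -> S}) (z t : S) (c : 'M[F]_n) :
    corner_hom a -> corner_hom a' -> z * a' (E 0 0) * t = a (E 0 0) ->
  (\sum_i a (E i 0) * z * a' (E 0 i)) * a' c *
    (\sum_i a' (E i 0) * t * a (E 0 i)) = a c.
  move=> aM a'M zt.
  rewrite (matrix_sum_scale a c) !mulr_suml; apply: eq_bigr => i _.
  rewrite mulr_sumr; apply: eq_bigr => j _.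
  have -> : a (E i 0) * z * a' (E 0 i) * a' c * (a' (E j 0) * t * a (E 0 j)) =
            a (E i 0) * z * (a' (E 0 i) * a' c * a' (E j 0)) * t * a (E 0 j).
    by rewrite !mulrA.
  rewrite -!a'M delta_sandwich linearZ /= -scalerAr -!scalerAl; congr (_ *: _).
  rewrite -(mulrA (a _) z) -(mulrA (a _) (z * _)) zt -!aM.
  by rewrite !delta_mul !eqxx.
exists (\sum_i b (E i 0) * x * b' (E 0 i)), (\sum_i b' (E i 0) * y * b (E 0 i)).
move=> c; split; apply: half => //; first by rewrite xb.
by rewrite yb.
Qed.

End Matrix.

Section Product.

Variables B1 B2 : semiAlgType F.
Local Notation B := (B1 * B2)%type.

Lemma pair_compl (p1 : B1) (p2 : B2) :
  el_compl p1 -> el_compl p2 -> el_compl ((p1, p2) : B).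
Proof.
move=> [q1 [e1 e2 e3]] [q2 [f1 f2 f3]]; exists (q1, q2).
by split; congr pair.
Qed.

Lemma compl_pair (p : B) : el_compl p -> el_compl p.1 /\ el_compl p.2.
Proof.
move=> [[q1 q2] [e1 e2 e3]]; split; [exists q1|exists q2].
  by split; [move: e1|move: e2|move: e3] => /(congr1 fst).
by split; [move: e1|move: e2|move: e3] => /(congr1 snd).
Qed.

Lemma inl_linear (V : lSemiModType F) (b : {linear B -> V}) :
  exists b1 : {linear B1 -> V}, forall c, b1 c = b (c, 0).
Proof.
apply: linear_exists; split=> [a c | c d]; rewrite -?linearZ -?linearD.
  by congr (b _); congr pair; rewrite scaler0.
by congr (b _); congr pair; rewrite addr0.
Qed.

Lemma inr_linear (V : lSemiModType F) (b : {linear B -> V}) :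
  exists b2 : {linear B2 -> V}, forall c, b2 c = b (0, c).
Proof.
apply: linear_exists; split=> [a c | c d]; rewrite -?linearZ -?linearD.
  by congr (b _); congr pair; rewrite scaler0.
by congr (b _); congr pair; rewrite addr0.
Qed.

Lemma pair_mul (x y : B) : x * y = (x.1 * y.1, x.2 * y.2).
Proof. by []. Qed.

Lemma pair_orth (p1 : B1) (p2 : B2) : p1 * p1 = p1 -> p2 * p2 = p2 ->
  el_orth ((p1, 0) : B) (0, p2).
Proof.
by move=> i1 i2; split; rewrite pair_mul /= ?mulr0 ?mul0r ?i1 ?i2.
Qed.

Lemma pair_sum (c1 : B1) (c2 : B2) : (c1, c2) = (c1, 0) + (0, c2) :> B.
Proof. by congr pair; rewrite ?addr0 ?add0r. Qed.

(** Splitting [u] along 1 = (1, 0) + (0, 1) gives orthogonal corners; lifts of the two factors into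
    them annihilate each other and can be added. *)
Lemma prod_lifts_exist : lifts_exist B1 -> lifts_exist B2 -> lifts_exist B.
Proof.
move=> ex1 ex2 S g u cS kg cu gu; have [gD gM gpos] := kg.
have kg1 : k_functional (fun c : B1 => g (c, 0)).
  split=> [p q [pp qq pq qp] | x y xy yx | p pp].
  - rewrite -gD; last by split; rewrite pair_mul /= ?pp ?qq ?pq ?qp mulr0.
    by congr g; congr pair; rewrite addr0.
  - have e (x' y' : B1) : (x' * y', 0) = (x', 0) * (y', 0) :> B.
      by rewrite pair_mul /= mulr0.
    by rewrite !e gM // -!e ?xy ?yx // -e ?xy ?yx.
  by apply: gpos; rewrite pair_mul /= pp mulr0.
have kg2 : k_functional (fun c : B2 => g (0, c)).
  split=> [p q [pp qq pq qp] | x y xy yx | p pp].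
  - rewrite -gD; last by split; rewrite pair_mul /= ?pp ?qq ?pq ?qp mulr0.
    by congr g; congr pair; rewrite addr0.
  - have e (x' y' : B2) : (0, x' * y') = (0, x') * (0, y') :> B.
      by rewrite pair_mul /= mulr0.
    by rewrite !e gM // -!e ?xy ?yx // -e ?xy ?yx.
  by apply: gpos; rewrite pair_mul /= pp mulr0.
have e1 : (1 : B) = (1, 0) + (0, 1) by exact: pair_sum.
have o1 : el_orth ((1, 0) : B) (0, 1) by apply: pair_orth; rewrite mulr1.
have [i1 i2 _ _] := o1.
have [u1 [u2 [ou eu cl1 cl2]]] :
    exists u1 u2, [/\ el_orth u1 u2, u1 + u2 = u, el_class u1 = g (1, 0)
                   & el_class u2 = g (0, 1)].
  by apply: el_class_split => //; [exact: gpos|exact: gpos|rewrite -gD // -e1].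
have cu1 : el_compl u1 by apply: (el_compl_orth ou); rewrite eu.
have cu2 : el_compl u2 by apply: (el_compl_orth (el_orthC ou)); rewrite addrC eu.
have [b1 [b1M b11 b1cl]] := ex1 S _ u1 cS kg1 cu1 cl1.
have [b2 [b2M b21 b2cl]] := ex2 S _ u2 cS kg2 cu2 cl2.
have [b bE] : exists b : {linear B -> S}, forall c, b c = b1 c.1 + b2 c.2.
  apply: linear_exists; split=> [a c | c d] /=.
    by rewrite !linearZ scalerDr.
  by rewrite !linearD addrACA.
have [uu1 uu2 u12 u21] := ou.
have b12 x y : b1 x * b2 y = 0.
  rewrite -[x]mulr1 -[y]mul1r b1M b2M b11 b21.
  by rewrite mulrA -(mulrA (b1 x)) u12 mulr0 mul0r.
have b21' x y : b2 y * b1 x = 0.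
  rewrite -[x]mul1r -[y]mulr1 b1M b2M b11 b21.
  by rewrite mulrA -(mulrA (b2 y)) u21 mulr0 mul0r.
exists b; split=> [x y | | p cp].
- rewrite !bE pair_mul /= mulrDl !mulrDr b12 b21' b1M b2M.
  by rewrite addr0 add0r.
- by rewrite bE /= b11 b21.
have [cp1 cp2] := compl_pair cp.
have [ip1 ip2] := (el_compl_idem cp1, el_compl_idem cp2).
rewrite [in RHS](surjective_pairing p) pair_sum gD; last exact: pair_orth.
rewrite bE el_classD ?b1cl ?b2cl //.
by split; rewrite ?b12 ?b21' // -?b1M -?b2M ?ip1 ?ip2.
Qed.

(** The conjugating elements of the factors are cut down by the images of (1, 0) and (0, 1) before
    being added, which kills the mixed terms. *)
Lemma prod_lifts_conj : lifts_conj B1 -> lifts_conj B2 -> lifts_conj B.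
Proof.
move=> cj1 cj2 S b b' cS bM b'M cb cb' bb'.
have c1 : el_compl ((1, 0) : B).
  apply: pair_compl; first exact: el_compl1.
  by exists 1; rewrite mulr0 mul0r add0r.
have c2 : el_compl ((0, 1) : B).
  apply: pair_compl; last exact: el_compl1.
  by exists 1; rewrite mulr0 mul0r add0r.
have [b1 b1E] := inl_linear b; have [b2 b2E] := inr_linear b.
have [b1' b1E'] := inl_linear b'; have [b2' b2E'] := inr_linear b'.
have [x1 [y1 xy1]] : exists x y : S, forall c,
    x * b1' c * y = b1 c /\ y * b1 c * x = b1' c.
  apply: cj1 => //.
  - by move=> x y; rewrite !b1E -bM pair_mul /= mulr0.
  - by move=> x y; rewrite !b1E' -b'M pair_mul /= mulr0.
  - by rewrite b1E; exact: corner_compl.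
  - by rewrite b1E'; exact: corner_compl.
  move=> p cp; rewrite b1E b1E' bb' //; apply: pair_compl => //.
  by exists 1; rewrite mulr0 mul0r add0r.
have [x2 [y2 xy2]] : exists x y : S, forall c,
    x * b2' c * y = b2 c /\ y * b2 c * x = b2' c.
  apply: cj2 => //.
  - by move=> x y; rewrite !b2E -bM pair_mul /= mulr0.
  - by move=> x y; rewrite !b2E' -b'M pair_mul /= mulr0.
  - by rewrite b2E; exact: corner_compl.
  - by rewrite b2E'; exact: corner_compl.
  move=> p cp; rewrite b2E b2E' bb' //; apply: pair_compl => //.
  by exists 1; rewrite mulr0 mul0r add0r.
have half (a a' : {linear B -> S}) (z1 z2 t1 t2 : S) (c : B) :
    corner_hom a -> corner_hom a' ->
    (forall d, z1 * a' (d, 0) * t1 = a (d, 0)) ->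
    (forall d, z2 * a' (0, d) * t2 = a (0, d)) ->
  (a (1, 0) * z1 * a' (1, 0) + a (0, 1) * z2 * a' (0, 1)) * a' c *
  (a' (1, 0) * t1 * a (1, 0) + a' (0, 1) * t2 * a (0, 1)) = a c.
  move=> aM a'M h1 h2; case: c => d1 d2.
  have -> : a (d1, d2) = a (1, 0) * a (d1, 0) * a (1, 0) +
                         a (0, 1) * a (0, d2) * a (0, 1).
    by rewrite -!aM !pair_mul /= !(mulr1, mul1r, mulr0) -linearD -pair_sum.
  have e11 : a' (1, 0) * a' (d1, d2) * a' (1, 0) = a' (d1, 0).
    by rewrite -!a'M !pair_mul /= !(mulr1, mul1r, mulr0, mul0r).
  have e12 : a' (1, 0) * a' (d1, d2) * a' (0, 1) = 0.
    by rewrite -!a'M !pair_mul /= !(mulr1, mul1r, mulr0, mul0r) linear0.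
  have e21 : a' (0, 1) * a' (d1, d2) * a' (1, 0) = 0.
    by rewrite -!a'M !pair_mul /= !(mulr1, mul1r, mulr0, mul0r) linear0.
  have e22 : a' (0, 1) * a' (d1, d2) * a' (0, 1) = a' (0, d2).
    by rewrite -!a'M !pair_mul /= !(mulr1, mul1r, mulr0, mul0r).
  have assoc (k l m n o p q : S) :
    k * l * m * n * (o * p * q) = k * (l * (m * n * o) * p) * q by rewrite !mulrA.
  rewrite !mulrDl !mulrDr !assoc e11 e12 e21 e22 h1 h2.
  by rewrite !(mulr0, mul0r) addr0 add0r.
exists (b (1, 0) * x1 * b' (1, 0) + b (0, 1) * x2 * b' (0, 1)).
exists (b' (1, 0) * y1 * b (1, 0) + b' (0, 1) * y2 * b (0, 1)).
move=> c; split; apply: half => // d; rewrite -?b1E -?b2E -?b1E' -?b2E'.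
- by case: (xy1 d).
- by case: (xy2 d).
- by case: (xy1 d).
- by case: (xy2 d).
Qed.

End Product.

Lemma matrix_prod_exist n s : lifts_exist (matrix_prod F n s).
Proof.
elim: s n => [|m s IH] n /=; first exact: matrix_lifts_exist.
by apply: prod_lifts_exist => //; exact: matrix_lifts_exist.
Qed.

Lemma matrix_prod_conj n s : lifts_conj (matrix_prod F n s).
Proof.
elim: s n => [|m s IH] n /=; first exact: matrix_lifts_conj.
by apply: prod_lifts_conj => //; exact: matrix_lifts_conj.
Qed.

Lemma matrix_prod_cancel n s : mx_cancel (matrix_prod F n s).
Proof.
have cM m : mx_cancel 'M[F]_m.+1.
  by apply: mx_cancel_matrix; exact: semifield_cancel.
elim: s n => [|m s IH] n /=; first exact: cM.
exact: mx_cancel_prod (cM n) (IH m).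
Qed.

(** A finite dual basis: as coordinates are linear, finitely many values define a linear map out of
    [B], and finitely many tests compare two of them. *)
Definition fin_spanned (B : semiAlgType F) : Prop :=
  exists (k : nat) (v : 'I_k -> B) (co : 'I_k -> {linear B -> F^o}),
    forall x, x = \sum_i co i x *: v i.

Lemma matrix_prod_spanned n s : fin_spanned (matrix_prod F n s).
Proof.
have hM m : fin_spanned 'M[F]_m.+1.
  have /choice[co coE] (i : 'I_(m.+1 * m.+1)) :
      exists c : {linear 'M[F]_m.+1 -> F^o}, forall x, c x = mxvec x 0 i.
    by apply: linear_exists; split=> [a x | x y]; rewrite ?linearZ ?linearD /= mxE.
  exists (m.+1 * m.+1)%N, (fun i => vec_mx (delta_mx 0 i)), co => x.
  rewrite -{1}(mxvecK x) {1}(row_sum_delta (mxvec x)) linear_sum.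
  by apply: eq_bigr => i _; rewrite linearZ coE.
elim: s n => [|m s IH] n /=; first exact: hM.
have [k [v [co e]]] := hM n; have [l [w [co' e']]] := IH m.
have /choice[c cE] (i : 'I_(k + l)) : exists c : {linear ('M[F]_n.+1 * matrix_prod F m s)%type -> F^o},
    forall x, c x = match split i with inl j => co j x.1 | inr j => co' j x.2 end.
  by apply: linear_exists; case: (split i) => j; split=> [a x | x y] /=;
     rewrite ?linearZ ?linearD.
exists (k + l)%N.
exists (fun i => match split i with inl j => (v j, 0) | inr j => (0, w j) end), c => x.
rewrite big_split_ord /=.
transitivity (\sum_i co i x.1 *: ((v i, 0) : ('M[F]_n.+1 * matrix_prod F m s)%type) +
              \sum_i co' i x.2 *: ((0, w i) : ('M[F]_n.+1 * matrix_prod F m s)%type)).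
  rewrite [LHS]surjective_pairing pair_sum {1}(e x.1) {1}(e' x.2); congr (_ + _).
    rewrite [RHS]surjective_pairing !raddf_sum /=; congr pair.
    by rewrite big1 // => i _; rewrite scaler0.
  rewrite [RHS]surjective_pairing !raddf_sum /=; congr pair.
  by rewrite big1 // => i _; rewrite scaler0.
congr (_ + _); apply: eq_bigr => i _; rewrite cE.
  by rewrite (unsplitK (inl i)).
by rewrite (unsplitK (inr i)).
Qed.

End Lifting.

(** * Direct limits *)

Lemma dep_choice (I : Type) (T : I -> Type) (P : forall i, T i -> Prop) :
  (forall i, exists x, P i x) -> exists f, forall i, P i (f i).
Proof. by move=> h; exists (fun i => sval (cid (h i))) => i; case: cid. Qed.

Lemma lrmorphism_exists (F : comNzSemiRingType) (A B : semiAlgType F)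
    (g : A -> B) :
  semilinear g -> monoid_morphism g -> exists gL : {lrmorphism A -> B}, gL =1 g.
Proof.
move=> lg mg.
pose gS := GRing.isSemilinear.Build _ _ _ _ g lg.
pose gM := GRing.isMonoidMorphism.Build _ _ g mg.
by exists (HB.pack g gS gM : {lrmorphism A -> B}).
Qed.

Lemma lrmorphism_inv (F : comNzSemiRingType) (A B : semiAlgType F)
    (f : {lrmorphism A -> B}) :
  bijective f -> exists g : {lrmorphism B -> A}, cancel f g /\ cancel g f.
Proof.
case=> g fK gK.
have [||h hE] := @lrmorphism_exists F B A g.
- exact: can2_semilinear fK gK.
- exact: can2_monoid_morphism fK gK.
by exists h; split=> x; rewrite hE.
Qed.

(** * Two test algebras for the universal property *)

Section SubAlgebra.

Variables (F : comNzSemiRingType) (L : semiAlgType F) (U : {pred L}).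
Hypothesis hU : GRing.subsemialg_closed U.

(** The closure proof is an argument so that the algebra structure can be found from the predicate
    alone. *)
Definition subalg_pred of GRing.subsemialg_closed U : {pred L} := U.
Local Notation V := (subalg_pred hU).

HB.instance Definition _ := GRing.isSubSemiAlgClosed.Build F L V hU.

Record subalg := Subalg { subalg_val : L; _ : subalg_val \in V }.

HB.instance Definition _ := [isSub for subalg_val].
HB.instance Definition _ := [Choice of subalg by <:].
HB.instance Definition _ := [SubChoice_isSubSemiAlgebra of subalg by <:].

End SubAlgebra.

(* The product of the [A i] modulo eventual equality; it detects when two
   elements of the [A i] have the same image in the direct limit. *)
Section ReducedProduct.

Variables (F : comNzSemiRingType) (A : nat -> semiAlgType F).

Local Notation seqs := (forall i, A i).

Definition ev_eq (x y : seqs) : bool :=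
  `[< exists N, forall j, (N <= j)%N -> x j = y j >].

Lemma ev_eqP x y :
  reflect (exists N, forall j, (N <= j)%N -> x j = y j) (ev_eq x y).
Proof. exact: asboolP. Qed.

Lemma ev_eq_refl : reflexive ev_eq.
Proof. by move=> x; apply/ev_eqP; exists 0. Qed.

Lemma ev_eq_sym : symmetric ev_eq.
Proof.
by move=> x y; apply/ev_eqP/ev_eqP => -[N h]; exists N => j /h.
Qed.

Lemma ev_eq_trans : transitive ev_eq.
Proof.
move=> y x z /ev_eqP[N h] /ev_eqP[M k]; apply/ev_eqP; exists (maxn N M) => j.
by rewrite geq_max => /andP[/h -> /k].
Qed.

Definition ev_equiv := EquivRel ev_eq ev_eq_refl ev_eq_sym ev_eq_trans.
Canonical ev_equiv.

Definition red_prod := {eq_quot ev_equiv}.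

HB.instance Definition _ := Choice.on red_prod.

Definition rp_pi (x : seqs) : red_prod := \pi_red_prod x.

Lemma rp_piP x y : rp_pi x = rp_pi y <-> exists N, forall j, (N <= j)%N -> x j = y j.
Proof. by split=> [/eqquotP/ev_eqP | h] //; apply/eqquotP/ev_eqP. Qed.

Lemma rp_reprK (u : red_prod) : rp_pi (repr u) = u.
Proof. exact: reprK. Qed.

Definition rp_op1 (f : forall i, A i -> A i) (u : red_prod) : red_prod :=
  rp_pi (fun i => f i (repr u i)).

Definition rp_op2 (f : forall i, A i -> A i -> A i) (u v : red_prod) : red_prod :=
  rp_pi (fun i => f i (repr u i) (repr v i)).

Lemma rp_op1E f x : rp_op1 f (rp_pi x) = rp_pi (fun i => f i (x i)).
Proof.
apply/rp_piP; have /rp_piP[N h] := rp_reprK (rp_pi x).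
by exists N => j /h ->.
Qed.

Lemma rp_op2E f x y :
  rp_op2 f (rp_pi x) (rp_pi y) = rp_pi (fun i => f i (x i) (y i)).
Proof.
apply/rp_piP; have /rp_piP[N h] := rp_reprK (rp_pi x).
have /rp_piP[M k] := rp_reprK (rp_pi y); exists (maxn N M) => j.
by rewrite geq_max => /andP[/h -> /k ->].
Qed.

Lemma rpW (P : red_prod -> Prop) : (forall x, P (rp_pi x)) -> forall u, P u.
Proof. by move=> h u; rewrite -(rp_reprK u). Qed.

Lemma rp_eq x y : (forall i, x i = y i) -> rp_pi x = rp_pi y.
Proof. by move=> h; apply/rp_piP; exists 0 => j _. Qed.

Definition rp_zero := rp_pi (fun=> 0).
Definition rp_one := rp_pi (fun=> 1).
Definition rp_add := rp_op2 (fun i => @GRing.add (A i)).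
Definition rp_mul := rp_op2 (fun i => @GRing.mul (A i)).
Definition rp_scale (a : F) := rp_op1 (fun i (x : A i) => a *: x).

Local Ltac rp_law l := do ![elim/rpW => ?];
  rewrite /rp_add /rp_mul /rp_scale /rp_one /rp_zero ?(rp_op2E, rp_op1E);
  apply: rp_eq => i; exact: l.

Lemma rp_addA : associative rp_add. Proof. rp_law addrA. Qed.
Lemma rp_addC : commutative rp_add. Proof. rp_law addrC. Qed.
Lemma rp_add0 : left_id rp_zero rp_add. Proof. rp_law add0r. Qed.

HB.instance Definition _ := GRing.isNmodule.Build red_prod rp_addA rp_addC rp_add0.

Lemma rp_mulA : associative rp_mul. Proof. rp_law mulrA. Qed.
Lemma rp_mul1r : left_id rp_one rp_mul. Proof. rp_law mul1r. Qed.
Lemma rp_mulr1 : right_id rp_one rp_mul. Proof. rp_law mulr1. Qed.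
Lemma rp_mulDl : left_distributive rp_mul rp_add. Proof. rp_law mulrDl. Qed.
Lemma rp_mulDr : right_distributive rp_mul rp_add. Proof. rp_law mulrDr. Qed.
Lemma rp_mul0r : left_zero rp_zero rp_mul. Proof. rp_law mul0r. Qed.
Lemma rp_mulr0 : right_zero rp_zero rp_mul. Proof. rp_law mulr0. Qed.
Lemma rp_one_neq0 : rp_one != rp_zero.
Proof.
apply/eqP=> /rp_piP[N /(_ N (leqnn N))] /eqP; exact/negP/oner_neq0.
Qed.

HB.instance Definition _ := GRing.Nmodule_isNzSemiRing.Build red_prod
  rp_mulA rp_mul1r rp_mulr1 rp_mulDl rp_mulDr rp_mul0r rp_mulr0 rp_one_neq0.

Lemma rp_scaleA a b u : rp_scale a (rp_scale b u) = rp_scale (a * b) u.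
Proof. move: u; rp_law scalerA. Qed.
Lemma rp_scale0 u : rp_scale 0 u = rp_zero.
Proof. move: u; rp_law scale0r. Qed.
Lemma rp_scale1 : left_id 1 rp_scale. Proof. rp_law scale1r. Qed.
Lemma rp_scaleDr : right_distributive rp_scale rp_add.
Proof. move=> a; rp_law scalerDr. Qed.
Lemma rp_scaleDl u : {morph rp_scale^~ u : a b / a + b >-> rp_add a b}.
Proof. move=> a b; move: u; rp_law scalerDl. Qed.

HB.instance Definition _ := GRing.Nmodule_isLSemiModule.Build F red_prod
  rp_scaleA rp_scale0 rp_scale1 rp_scaleDr rp_scaleDl.

Lemma rp_scaleAl (a : F) (u v : red_prod) : a *: (u * v) = (a *: u) * v.
Proof.
rewrite /GRing.scale /GRing.mul /=; move: u v; rp_law scalerAl.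
Qed.

HB.instance Definition _ := GRing.LSemiModule_isLSemiAlgebra.Build F red_prod
  rp_scaleAl.

Lemma rp_scaleAr (a : F) (u v : red_prod) : a *: (u * v) = u * (a *: v).
Proof.
rewrite /GRing.scale /GRing.mul /=; move: u v; rp_law scalerAr.
Qed.

HB.instance Definition _ := GRing.LSemiAlgebra_isSemiAlgebra.Build F red_prod
  rp_scaleAr.

Lemma rp_piD x y : rp_pi x + rp_pi y = rp_pi (fun i => x i + y i).
Proof. exact: rp_op2E. Qed.
Lemma rp_piM x y : rp_pi x * rp_pi y = rp_pi (fun i => x i * y i).
Proof. exact: rp_op2E. Qed.
Lemma rp_piZ (a : F) x : a *: rp_pi x = rp_pi (fun i => a *: x i).
Proof. exact: (rp_op1E (fun i (x : A i) => a *: x)). Qed.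

End ReducedProduct.

(** * Elements of a direct limit *)

Section Transition.

Variables (F : comNzSemiRingType) (A : nat -> semiAlgType F).
Variable phi : forall i, {lrmorphism A i -> A i.+1}.

Definition level_cast i j (x : A i) : A j :=
  if @eqP _ i j is ReflectT e then ecast k (A k) e x else 0.

Lemma level_cast_id i (x : A i) : level_cast i x = x.
Proof. by rewrite /level_cast; case: eqP => // e; rewrite eq_axiomK. Qed.

(* The transition map from level [i] to level [j]; junk when [j < i]. *)
Fixpoint trans i (x : A i) j : A j :=
  match j with
  | 0 => level_cast 0 x
  | j'.+1 => if i == j'.+1 then level_cast j'.+1 x else phi j' (trans x j')
  end.

Lemma trans_id i (x : A i) : trans x i = x.
Proof. by case: i x => [|i] x; rewrite /= ?eqxx level_cast_id. Qed.

Lemma transS i (x : A i) j : (i <= j)%N -> trans x j.+1 = phi j (trans x j).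
Proof. by move=> ij /=; rewrite ltn_eqF. Qed.

Lemma trans_trans i (x : A i) j k :
  (i <= j)%N -> (j <= k)%N -> trans (trans x j) k = trans x k.
Proof.
move=> ij; elim: k => [|k IH]; first by rewrite leqn0 => /eqP->; rewrite trans_id.
rewrite leq_eqVlt => /predU1P[->|]; first by rewrite trans_id.
by rewrite ltnS => jk; rewrite !transS ?IH // (leq_trans ij).
Qed.

Lemma trans_step i (x : A i) j :
  (i < j)%N -> trans (phi i x) j = trans x j.
Proof.
by move=> ij; rewrite -(trans_trans x (leqnSn i) ij) transS // trans_id.
Qed.

Lemma trans_lrmorphism i j : (i <= j)%N ->
  exists h : {lrmorphism A i -> A j}, forall x, h x = trans x j.
Proof.
elim: j => [|j IH].
  by rewrite leqn0 => /eqP i0; rewrite i0; exists idfun => x; rewrite trans_id.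
rewrite leq_eqVlt => /predU1P[->|].
  by exists idfun => x; rewrite trans_id.
rewrite ltnS => ij; have [h hE] := IH ij; exists (phi j \o h) => x.
by rewrite transS //= hE.
Qed.

Lemma cocone_trans (B : semiAlgType F) (psi : forall i, {lrmorphism A i -> B}) :
  is_cocone phi psi ->
  forall i j (x : A i), (i <= j)%N -> psi j (trans x j) = psi i x.
Proof.
move=> cc i; elim=> [|j IH] x.
  by rewrite leqn0 => /eqP i0; case: _ / (esym i0) x => x; rewrite trans_id.
rewrite leq_eqVlt => /predU1P[e|].
  by case: _ / e; rewrite trans_id.
by rewrite ltnS => ij; rewrite transS // cc IH.
Qed.

Variables (L : semiAlgType F) (psi : forall i, {lrmorphism A i -> L}).
Hypothesis lim : is_direct_limit phi psi.

Lemma limit_cocone : is_cocone phi psi.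
Proof. by case: lim. Qed.

Lemma limit_trans i j (x : A i) : (i <= j)%N -> psi j (trans x j) = psi i x.
Proof. exact: cocone_trans limit_cocone _ _ _. Qed.

Definition limit_union : {pred L} := fun x => `[< exists i y, psi i y = x >].

Lemma limit_union_pair x y : x \in limit_union -> y \in limit_union ->
  exists i u v, psi i u = x /\ psi i v = y.
Proof.
move=> /asboolP[i [u <-]] /asboolP[j [v <-]].
exists (maxn i j), (trans u (maxn i j)), (trans v (maxn i j)).
by rewrite !limit_trans ?leq_maxl ?leq_maxr.
Qed.

Lemma limit_union_closed : GRing.subsemialg_closed limit_union.
Proof.
split.
- by apply/asboolP; exists 0, 1; rewrite rmorph1.
- split; first by apply/asboolP; exists 0, 0; rewrite rmorph0.
  move=> x y ux uy; have [i [u [v [<- <-]]]] := limit_union_pair ux uy.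
  by apply/asboolP; exists i, (u + v); rewrite rmorphD.
- move=> a x /asboolP[i [u <-]]; apply/asboolP.
  by exists i, (a *: u); rewrite linearZ.
move=> x y ux uy; have [i [u [v [<- <-]]]] := limit_union_pair ux uy.
by apply/asboolP; exists i, (u * v); rewrite rmorphM.
Qed.

(* The union of the images is a subalgebra through which the identity of the
   limit factors, by the two halves of the universal property. *)
Lemma limit_surj (x : L) : exists i (y : A i), psi i y = x.
Proof.
have [cc univ] := lim; pose V : semiAlgType F := subalg limit_union_closed.
have inV i (y : A i) : psi i y \in subalg_pred limit_union_closed.
  by apply/asboolP; exists i, y.
have /dep_choice[chi chiE] (i : nat) : exists chi : {lrmorphism A i -> V},
    forall y, val (chi y) = psi i y.
  have [||chi chiE] := @lrmorphism_exists F (A i) V (fun y => Subalg (inV i y)).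
  - by split=> [a y | y z]; apply: val_inj; rewrite /= ?linearZ ?rmorphD.
  - by split=> [|y z]; apply: val_inj; rewrite /= ?rmorph1 ?rmorphM.
  by exists chi => y; rewrite chiE.
have ccV : is_cocone phi chi.
  by move=> i y; apply: val_inj; rewrite !chiE cc.
have [h [hE _]] := univ V chi ccV.
have [k kE] : exists k : {lrmorphism V -> L}, k =1 val.
  by apply: lrmorphism_exists; split.
have [h0 [_ uniq]] := univ L psi cc.
have /asboolP[i [y e]] := valP (h x).
exists i, y; rewrite e -kE.
have -> : k (h x) = h0 x.
  by apply: (uniq (k \o h)) => j z /=; rewrite kE hE chiE.
by rewrite -(uniq idfun).
Qed.

(** Sending an element to its trajectory is a homomorphism to the reduced product, where the junk
    below the starting level disappears. These maps form a cocone, hence factor through the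
    limit. *)
Lemma limit_eq i (x y : A i) : psi i x = psi i y ->
  exists N, forall j, (N <= j)%N -> trans x j = trans y j.
Proof.
have [_ univ] := lim => exy.
have /dep_choice[chi chiE] (l : nat) :
    exists chi : {lrmorphism A l -> red_prod A},
    forall z, chi z = rp_pi (fun j => trans z j).
  apply: lrmorphism_exists; [split=> [a z | z t] | split=> [| z t]].
  - rewrite rp_piZ; apply/rp_piP; exists l => j lj.
    by have [h hE] := trans_lrmorphism lj; rewrite -!hE linearZ.
  - rewrite rp_piD; apply/rp_piP; exists l => j lj.
    by have [h hE] := trans_lrmorphism lj; rewrite -!hE rmorphD.
  - apply/rp_piP; exists l => j lj.
    by have [h hE] := trans_lrmorphism lj; rewrite -!hE rmorph1.
  rewrite rp_piM; apply/rp_piP; exists l => j lj.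
  by have [h hE] := trans_lrmorphism lj; rewrite -!hE rmorphM.
have [|h [hE _]] := univ (red_prod A) chi.
  move=> l z; rewrite !chiE; apply/rp_piP; exists l.+1 => j lj.
  by rewrite trans_step.
by apply/rp_piP; rewrite -!chiE -!hE exy.
Qed.

End Transition.

(** From some level on, rather than at some level, so that finitely many conditions can be met
    together. *)
Definition eventually (P : nat -> Prop) : Prop :=
  exists N, forall j, (N <= j)%N -> P j.

Lemma eventually_ge N : eventually (fun j => N <= j)%N.
Proof. by exists N. Qed.

Lemma eventually_and P Q :
  eventually P -> eventually Q -> eventually (fun j => P j /\ Q j).
Proof.
move=> [N h] [M k]; exists (maxn N M) => j.
by rewrite geq_max => /andP[/h Pj /k Qj].
Qed.

Lemma eventually_impl (P Q : nat -> Prop) :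
  eventually P -> (forall j, P j -> Q j) -> eventually Q.
Proof. by move=> [N h] k; exists N => j /h /k. Qed.

Lemma eventually_ex P : eventually P -> exists j, P j.
Proof. by case=> N /(_ N (leqnn N)); exists N. Qed.

Lemma eventually_fin (I : finType) (P : I -> nat -> Prop) :
  (forall i, eventually (P i)) -> eventually (fun j => forall i, P i j).
Proof.
move=> /choice[N h]; exists (\max_i N i) => j le i; apply: h.
exact: leq_trans (leq_bigmax i) le.
Qed.

(** * Descent of matrices and homomorphisms to finite levels *)

Section Limit.

Variables (F : comNzSemiRingType) (A : nat -> semiAlgType F).
Variable phi : forall i, {lrmorphism A i -> A i.+1}.
Variables (L : semiAlgType F) (psi : forall i, {lrmorphism A i -> L}).
Hypothesis lim : is_direct_limit phi psi.
Local Notation trans := (trans phi).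

Lemma limit_lift (x : L) : eventually (fun j => exists y, psi j y = x).
Proof.
have [i [y <-]] := limit_surj lim x; exists i => j ij.
by exists (trans y j); rewrite (limit_trans lim).
Qed.

Lemma limit_lift_mx m n (X : 'M[L]_(m, n)) :
  eventually (fun j => exists Y : 'M[A j]_(m, n), map_mx (psi j) Y = X).
Proof.
apply: (@eventually_impl
  (fun j => forall u : 'I_m * 'I_n, exists y, psi j y = X u.1 u.2)).
  by apply: eventually_fin => u; exact: limit_lift.
move=> j /choice[y yE]; exists (\matrix_(s, t) y (s, t)).
by apply/matrixP=> s t; rewrite !mxE yE.
Qed.

Lemma limit_eq_mx i m n (X Y : 'M[A i]_(m, n)) :
  map_mx (psi i) X = map_mx (psi i) Y ->
  eventually (fun j => map_mx (fun x => trans x j) X =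
                       map_mx (fun x => trans x j) Y).
Proof.
move=> /matrixP e; apply: (@eventually_impl
  (fun j => forall u : 'I_m * 'I_n, trans (X u.1 u.2) j = trans (Y u.1 u.2) j)).
  apply: eventually_fin => u; apply: (limit_eq lim).
  by move: (e u.1 u.2); rewrite !mxE.
by move=> j h; apply/matrixP=> s t; rewrite !mxE (h (s, t)).
Qed.

(** The data are finitely many matrices satisfying finitely many equations, so they live at one
    level; the equivalence obtained there maps forward to the limit. *)
Lemma mx_cancel_limit : (forall i, mx_cancel (A i)) -> mx_cancel L.
Proof.
move=> cA m n k P p r iP ir [q [pq qp e1]] [X [Y [XY YX]]].
have [i [[[P' P'E] [p' p'E]] [[r' r'E] [[q' q'E] [[X' X'E] [Y' Y'E]]]]]] :=
  eventually_ex (eventually_and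
    (eventually_and (limit_lift_mx P) (limit_lift_mx p))
    (eventually_and (limit_lift_mx r) (eventually_and (limit_lift_mx q)
      (eventually_and (limit_lift_mx X) (limit_lift_mx Y))))).
have/limit_eq_mx h1 : map_mx (psi i) (P' *m P') = map_mx (psi i) P'.
  by rewrite map_mxM P'E.
have/limit_eq_mx h2 : map_mx (psi i) (r' *m r') = map_mx (psi i) r'.
  by rewrite map_mxM r'E.
have/limit_eq_mx h3 : map_mx (psi i) (p' *m q') = map_mx (psi i) 0.
  by rewrite map_mxM p'E q'E map_mx0.
have/limit_eq_mx h4 : map_mx (psi i) (q' *m p') = map_mx (psi i) 0.
  by rewrite map_mxM p'E q'E map_mx0.
have/limit_eq_mx h5 : map_mx (psi i) (p' + q') = map_mx (psi i) 1%:M.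
  by rewrite map_mxD p'E q'E map_mx1.
have/limit_eq_mx h6 : map_mx (psi i) (X' *m Y') = map_mx (psi i) (mx_dsum P' r').
  by rewrite map_mxM map_mx_dsum X'E Y'E P'E r'E.
have/limit_eq_mx h7 : map_mx (psi i) (Y' *m X') = map_mx (psi i) (mx_dsum p' r').
  by rewrite map_mxM map_mx_dsum X'E Y'E p'E r'E.
have [j [ij [[[g1 g2] [g3 g4]] [g5 [g6 g7]]]]] :=
  eventually_ex (eventually_and (eventually_ge i) (eventually_and
    (eventually_and (eventually_and h1 h2) (eventually_and h3 h4))
    (eventually_and h5 (eventually_and h6 h7)))).
have [h hE] := trans_lrmorphism phi ij.
have hmx a b (Z : 'M[A i]_(a, b)) : map_mx (fun x => trans x j) Z = map_mx h Z.
  by apply: eq_map_mx => x; rewrite hE.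
have psih a b (Z : 'M[A i]_(a, b)) : map_mx (psi j) (map_mx h Z) = map_mx (psi i) Z.
  by apply/matrixP=> s t; rewrite !mxE hE (limit_trans lim).
rewrite -P'E -p'E -!psih; apply: map_mx_sim.
apply: (cA j _ _ _ _ _ (map_mx h r')).
- by move: g1; rewrite !hmx map_mxM.
- by move: g2; rewrite !hmx map_mxM.
- exists (map_mx h q'); move: g3 g4 g5.
  by rewrite !hmx !map_mxM map_mxD map_mx0 map_mx1.
exists (map_mx h X'), (map_mx h Y').
by move: g6 g7; rewrite !hmx !map_mxM !map_mx_dsum.
Qed.

Lemma limit_hom_lift (B : semiAlgType F) (b : {lrmorphism B -> L}) :
  fin_spanned B ->
  eventually (fun j => exists b' : {lrmorphism B -> A j},
                       forall x, psi j (b' x) = b x).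
Proof.
move=> [k [v [co coE]]].
have [i /choice[a aE]] : exists i, forall t, exists y, psi i y = b (v t).
  by apply: eventually_ex; apply: eventually_fin => t; exact: limit_lift.
(* A linear lift of [b] built from preimages of the spanning elements; it becomes multiplicative and
   unital only further along. *)
have [be beE] : exists be : {linear B -> A i}, forall x, be x = \sum_t co t x *: a t.
  apply: linear_exists; split=> [c x | x y].
    rewrite scaler_sumr; apply: eq_bigr => t _.
    by rewrite linearZ scalerA.
  by rewrite -big_split; apply: eq_bigr => t _; rewrite linearD scalerDl.
have psibe x : psi i (be x) = b x.
  rewrite beE {2}(coE x) !linear_sum; apply: eq_bigr => t _.
  by rewrite !linearZ /= aE.
(* By bilinearity the pairs of spanning elements suffice, which leaves finitely many equations true
   in the limit. *)
have evM : eventually (fun j => forall u : 'I_k * 'I_k,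
    trans (be (v u.1 * v u.2)) j = trans (be (v u.1) * be (v u.2)) j).
  apply: eventually_fin => u; apply: (limit_eq lim).
  by rewrite rmorphM /= !psibe rmorphM.
have ev1 : eventually (fun j => trans (be 1) j = trans (1 : A i) j).
  by apply: (limit_eq lim); rewrite psibe !rmorph1.
apply: eventually_impl (eventually_and (eventually_ge i) (eventually_and evM ev1)) _.
move=> j [ij [jM j1]]; have [h hE] := trans_lrmorphism phi ij.
have [b' b'E] : exists b' : {lrmorphism B -> A j}, b' =1 (fun x => h (be x)).
  apply: lrmorphism_exists; [split=> [c x | x y] | split=> [| x y]].
  - by rewrite !linearZ.
  - by rewrite !linearD.
  - by rewrite hE j1 -hE rmorph1.
  rewrite {1}(coE x) {1}(coE y) mulr_suml !linear_sum.
  rewrite {2}(coE x) !linear_sum mulr_suml; apply: eq_bigr => s _.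
  rewrite mulr_sumr !linear_sum {2}(coE y) !linear_sum mulr_sumr.
  apply: eq_bigr => t _; rewrite -scalerAl -scalerAr !linearZ /=.
  by rewrite -scalerAl -scalerAr hE (jM (s, t)) -hE rmorphM.
by exists b' => x; rewrite b'E hE (limit_trans lim).
Qed.

Lemma limit_hom_eq (B : semiAlgType F) i (b b' : {lrmorphism B -> A i}) :
  fin_spanned B -> (forall x, psi i (b x) = psi i (b' x)) ->
  eventually (fun j => forall x, trans (b x) j = trans (b' x) j).
Proof.
move=> [k [v [co coE]]] bb'.
have evv : eventually (fun j => forall t : 'I_k, trans (b (v t)) j = trans (b' (v t)) j).
  by apply: eventually_fin => t; apply: (limit_eq lim).
apply: eventually_impl (eventually_and (eventually_ge i) evv) _.
move=> j [ij jv] x; have [h hE] := trans_lrmorphism phi ij.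
rewrite -!hE (coE x) !linear_sum; apply: eq_bigr => t _.
by rewrite !linearZ /= !hE jv.
Qed.

Hypothesis cL : mx_cancel L.

Lemma limit_class_lift (B : semiAlgType F) (g : B -> K0 L) :
  lifts_exist B -> k_functional g -> g 1 = el_class 1 ->
  exists b : {lrmorphism B -> L}, forall p, el_compl p -> el_class (b p) = g p.
Proof.
move=> exB kg g1.
have [|b0 [b0M b01 b0cl]] := exB L g 1 cL kg (el_compl1 L).
  by rewrite g1.
have [||b bE] := @lrmorphism_exists F B L b0.
- by split=> [a x | x y]; rewrite ?linearZ ?linearD.
- by split.
by exists b => p cp; rewrite bE b0cl.
Qed.

Lemma limit_start (B : semiAlgType F) (g : B -> K0 L) :
  lifts_exist B -> fin_spanned B -> k_functional g -> g 1 = el_class 1 ->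
  exists k (b : {lrmorphism B -> A k}),
    forall p, el_compl p -> el_class (psi k (b p)) = g p.
Proof.
move=> exB fB kg /(limit_class_lift exB kg)[b bcl].
have [k [b' b'E]] := eventually_ex (limit_hom_lift b fB).
by exists k, b' => p cp; rewrite b'E bcl.
Qed.

Lemma lrmorphism_corner (B S : semiAlgType F) (b : {lrmorphism B -> S}) :
  corner_hom b.
Proof. by move=> x y; rewrite rmorphM. Qed.

Lemma rmorph_compl (B S : semiAlgType F) (b : {lrmorphism B -> S}) p :
  el_compl p -> el_compl (b p).
Proof.
by case=> q [pq qp e]; exists (b q); rewrite -!rmorphM -rmorphD pq qp e rmorph0 rmorph1.
Qed.

(** A lift [b0] of [g] makes the triangle with [a] and [psi i] commute up to conjugation.
    Conjugating [b0] makes it commute in the limit, and moving along the sequence makes it commute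
    at a finite level. *)
Lemma limit_step (B : semiAlgType F) (g : B -> K0 L) i (a : {lrmorphism A i -> B}) :
  lifts_exist B -> fin_spanned B -> lifts_conj (A i) -> fin_spanned (A i) ->
  k_functional g -> g 1 = el_class 1 ->
  (forall p, el_compl p -> g (a p) = el_class (psi i p)) ->
  exists k (b : {lrmorphism B -> A k}),
    [/\ (i < k)%N, forall x, b (a x) = trans x k
      & forall p, el_compl p -> el_class (psi k (b p)) = g p].
Proof.
move=> exB fB cjA fA kg g1 ga; have [b0 b0cl] := limit_class_lift exB kg g1.
have [|||||x [y xy]] := cjA L (psi i) (b0 \o a) cL.
- exact: lrmorphism_corner.
- exact: lrmorphism_corner.
- by rewrite rmorph1; exact: el_compl1.
- by rewrite rmorph1; exact: el_compl1.
- by move=> p cp /=; rewrite b0cl ?ga //; exact: rmorph_compl.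
have [xy1 yx1] : x * y = 1 /\ y * x = 1.
  by have := xy 1; rewrite !rmorph1 !mulr1.
have [||b bE] := @lrmorphism_exists F B L (fun c => x * b0 c * y).
- split=> [c d | c d]; first by rewrite linearZ -scalerAr -scalerAl.
  by rewrite rmorphD mulrDr mulrDl.
- split=> [|c d]; first by rewrite rmorph1 mulr1.
  by rewrite rmorphM -!mulrA (mulrA y) yx1 mul1r.
(* Conjugation preserves classes: [el_classM] exchanges [x * b0 p] and [y]. *)
have bcl p : el_compl p -> el_class (b p) = g p.
  move=> cp; rewrite -b0cl // bE.
  have ip : b0 p * b0 p = b0 p by rewrite -rmorphM el_compl_idem.
  have e : y * (x * b0 p) = b0 p by rewrite mulrA yx1 mul1r.
  rewrite -[in RHS]e; apply: el_classM; last by rewrite e.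
  by rewrite -!mulrA (mulrA y) yx1 mul1r (mulrA (b0 p)) ip.
have [j [ij [b1 b1E]]] :=
  eventually_ex (eventually_and (eventually_ge i) (limit_hom_lift b fB)).
have [h hE] := trans_lrmorphism phi ij.
have evA : eventually (fun k => forall z, trans ((b1 \o a) z) k = trans (h z) k).
  apply: limit_hom_eq => // z /=; rewrite b1E bE hE (limit_trans lim) //.
  by case: (xy z).
have [k [jk [ik kA]]] := eventually_ex (eventually_and (eventually_ge j)
  (eventually_and (eventually_ge i.+1) evA)).
have [h' h'E] := trans_lrmorphism phi jk.
exists k, (h' \o b1); split=> // [z | p cp] /=.
  by rewrite h'E (kA z) hE trans_trans.
by rewrite h'E (limit_trans lim) // b1E bcl.
Qed.

End Limit.

(** Turns the given limit into one whose levels are literally [matrix_prod] and whose limit is [S]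
    itself. *)
Lemma direct_limit_iso (F : comNzSemiRingType) (A M : nat -> semiAlgType F)
    (phi : forall i, {lrmorphism A i -> A i.+1}) (L S : semiAlgType F)
    (psi : forall i, {lrmorphism A i -> L}) :
  is_direct_limit phi psi -> (forall i, alg_iso (A i) (M i)) -> alg_iso S L ->
  exists (phi' : forall i, {lrmorphism M i -> M i.+1})
         (psi' : forall i, {lrmorphism M i -> S}), is_direct_limit phi' psi'.
Proof.
move=> [cc univ] /dep_choice[th th_bij] [si /lrmorphism_inv[si' [siK si'K]]].
have /dep_choice[th' thK] i := lrmorphism_inv (th_bij i).
exists (fun i => th i.+1 \o (phi i \o th' i)), (fun i => si' \o (psi i \o th' i)).
split=> [i x | B chi ccB] /=; first by rewrite (thK i.+1).1 cc.
have [|h [hE uniq]] := univ B (fun i => chi i \o th i).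
  by move=> i x /=; rewrite -[RHS]ccB /= (thK i).1.
exists (h \o si); split=> [i x | h' h'E x] /=.
  by rewrite si'K hE /= (thK i).2.
rewrite -(siK x) -(uniq (h' \o si')) /= ?siK // => i y /=.
by rewrite -h'E /= (thK i).1.
Qed.

Lemma ultramatricial_tower (F : comNzSemiRingType) (S : semiAlgType F) :
  ultramatricial S ->
  exists (ns : nat -> nat * seq nat),
  let M i := matrix_prod F (ns i).1 (ns i).2 in
  exists (phi : forall i, {lrmorphism M i -> M i.+1})
         (psi : forall i, {lrmorphism M i -> S}), is_direct_limit phi psi.
Proof.
move=> [A [phi [L [psi [matA lim SL]]]]].
have /choice[ns nsE] i :
    exists ns : nat * seq nat, alg_iso (A i) (matrix_prod F ns.1 ns.2).
  by have [n [s e]] := matA i; exists (n, s).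
by exists ns; exact: direct_limit_iso lim nsE SL.
Qed.

(** * Isomorphism of limits from a commuting zigzag *)

Section Intertwining.

Variables (F : comNzSemiRingType) (A B : nat -> semiAlgType F).
Variable phi : forall i, {lrmorphism A i -> A i.+1}.
Variable rho : forall i, {lrmorphism B i -> B i.+1}.
Variables (S T : semiAlgType F).
Variable psi : forall i, {lrmorphism A i -> S}.
Variable tau : forall i, {lrmorphism B i -> T}.
Hypotheses (limS : is_direct_limit phi psi) (limT : is_direct_limit rho tau).

Variables (I J : nat -> nat) (a : forall m, {lrmorphism A (I m) -> B (J m)}).
Variable b : forall m, {lrmorphism B (J m) -> A (I m.+1)}.
Hypothesis ltI : forall m, (I m < I m.+1)%N.
Hypothesis ltJ : forall m, (J m < J m.+1)%N.
Hypothesis baE : forall m x, b m (a m x) = trans phi x (I m.+1).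
Hypothesis abE : forall m y, a m.+1 (b m y) = trans rho y (J m.+1).

Let leI m n : (m <= n)%N -> (I m <= I n)%N.
Proof.
move=> /subnK <-; elim: (n - m)%N => // k IH.
by rewrite addSn; exact: leq_trans IH (ltnW (ltI _)).
Qed.

Let leJ m n : (m <= n)%N -> (J m <= J n)%N.
Proof.
move=> /subnK <-; elim: (n - m)%N => // k IH.
by rewrite addSn; exact: leq_trans IH (ltnW (ltJ _)).
Qed.

Let geI m : (m <= I m)%N.
Proof. by elim: m => // m IH; exact: leq_ltn_trans IH (ltI m). Qed.

Let geJ m : (m <= J m)%N.
Proof. by elim: m => // m IH; exact: leq_ltn_trans IH (ltJ m). Qed.

Let a_trans m n x : (m <= n)%N -> a n (trans phi x (I n)) = trans rho (a m x) (J n).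
Proof.
move=> /subnK <-; elim: (n - m)%N => [|k IH]; first by rewrite !trans_id.
rewrite addSn -(trans_trans phi x (leI (leq_addl k m)) (ltnW (ltI _))).
rewrite -baE abE IH trans_trans //; first exact: leJ (leq_addl _ _).
exact: ltnW.
Qed.

Lemma intertwining_iso : alg_iso S T.
Proof.
(* A map is needed at every level [i], not only at the levels [I m]; since i <= I i, one moves up to
   [I i] and crosses there. *)
have /dep_choice[chi chiE] i : exists chi : {lrmorphism A i -> T},
    forall x, chi x = tau (J i) (a i (trans phi x (I i))).
  have [h hE] := trans_lrmorphism phi (geI i).
  by exists (tau (J i) \o (a i \o h)) => x /=; rewrite hE.
have [|h [hE _]] := limS.2 T chi.
  move=> i x; rewrite !chiE trans_step; last exact: leq_ltn_trans (geI i) (ltI i).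
  rewrite -(trans_trans phi x (geI i) (ltnW (ltI i))) a_trans //.
  by rewrite (limit_trans limT) // ltnW.
have haE m x : h (psi (I m) x) = tau (J m) (a m x).
  by rewrite hE chiE a_trans // (limit_trans limT) // leJ.
have h_inj : injective h.
  move=> s s' es.
  have [i [x xs]] := limit_surj limS s; have [i' [x' xs']] := limit_surj limS s'.
  pose m := maxn i i'.
  have im : (i <= I m)%N := leq_trans (leq_maxl i i') (geI m).
  have im' : (i' <= I m)%N := leq_trans (leq_maxr i i') (geI m).
  rewrite -xs -xs' -(limit_trans limS x im) -(limit_trans limS x' im') in es *.
  move: (trans phi x _) (trans phi x' _) es => {x x' xs xs' im im'} x x'.
  rewrite !haE => /(limit_eq limT)[N eN].
  (* With n >= N the level [J n] is past the point of agreement, and [b n] carries the equality back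
     to the first sequence. *)
  pose n := maxn m N; have mn : (m <= n)%N := leq_maxl m N.
  have := eN (J n) (leq_trans (leq_maxr m N) (geJ n)).
  rewrite -!a_trans // => /(congr1 (b n)); rewrite !baE.
  have In : (I n <= I n.+1)%N := ltnW (ltI n).
  rewrite !trans_trans ?leI // => e.
  by rewrite -(limit_trans limS x (leI (leqW mn))) e (limit_trans limS) // leI // leqW.
have h_surj t : exists s, h s = t.
  have [l [z <-]] := limit_surj limT t.
  (* [z] is moved up to level [J l] and back across by [b l]; crossing again by [a l.+1] returns a
     later image of [z]. *)
  exists (psi (I l.+1) (b l (trans rho z (J l)))).
  rewrite haE abE !(limit_trans limT) //; first exact: ltnW.
have /choice[h' h'K] := h_surj.
by exists h; exists h' => x //; apply: h_inj; rewrite h'K.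
Qed.

End Intertwining.

(** * Construction of the zigzag from the K_0 isomorphism *)

Section Elliott.

Variables (F : comNzSemiRingType) (A B : nat -> semiAlgType F).
Variable phi : forall i, {lrmorphism A i -> A i.+1}.
Variable rho : forall i, {lrmorphism B i -> B i.+1}.
Variables (S T : semiAlgType F).
Variable psi : forall i, {lrmorphism A i -> S}.
Variable tau : forall i, {lrmorphism B i -> T}.
Hypotheses (limS : is_direct_limit phi psi) (limT : is_direct_limit rho tau).
Hypotheses (cS : mx_cancel S) (cT : mx_cancel T).
Hypotheses (exA : forall i, lifts_exist (A i)) (exB : forall i, lifts_exist (B i)).
Hypotheses (cjA : forall i, lifts_conj (A i)) (cjB : forall i, lifts_conj (B i)).
Hypotheses (fA : forall i, fin_spanned (A i)) (fB : forall i, fin_spanned (B i)).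

Variables (f : K0 S -> K0 T) (g : K0 T -> K0 S).
Hypotheses (fK : cancel f g) (gK : cancel g f).
Hypothesis fD : {morph f : x y / K0_add x y >-> K0_add x y}.
Hypothesis gD : {morph g : x y / K0_add x y >-> K0_add x y}.
Hypotheses (fpos : forall x, K0_pos x -> K0_pos (f x))
           (gpos : forall x, K0_pos x -> K0_pos (g x)).
Hypothesis f1 : f (el_class 1) = el_class 1.

Let kf i : k_functional (fun p => f (el_class (psi i p))).
Proof.
have [hD hM hP] := corner_k_functional (@lrmorphism_corner _ _ _ (psi i)).
split=> [p q pq | x y xy yx | p pp].
- by rewrite hD // fD.
- by rewrite hM.
by apply: fpos; exact: hP.
Qed.

Let kg i : k_functional (fun p => g (el_class (tau i p))).
Proof.
have [hD hM hP] := corner_k_functional (@lrmorphism_corner _ _ _ (tau i)).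
split=> [p q pq | x y xy yx | p pp].
- by rewrite hD // gD.
- by rewrite hM.
by apply: gpos; exact: hP.
Qed.

Let compat i j (a : A i -> B j) : Prop := forall p, el_compl p ->
  el_class (tau j (a p)) = f (el_class (psi i p)).

(** The type of each map depends on levels chosen earlier, so the levels, the map and its
    compatibility with [f] are bundled to allow a recursion by choice. *)
Let state := {ij : nat * nat & {a : {lrmorphism A ij.1 -> B ij.2} | compat a}}.

Let next (s s' : state) : Prop :=
  [/\ ((tag s).1 < (tag s').1)%N, ((tag s).2 < (tag s').2)%N
    & exists b : {lrmorphism B (tag s).2 -> A (tag s').1},
      (forall x, b (sval (tagged s) x) = trans phi x (tag s').1) /\
      (forall y, sval (tagged s') (b y) = trans rho y (tag s').2)].

Let state0 : exists s : state, True.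
Proof.
have [|j [a ca]] := limit_start limT cT (@exA 0) (fA 0) (kf 0).
  by rewrite rmorph1.
by exists (existT (fun ij => {a : {lrmorphism A ij.1 -> B ij.2} | compat a})
             (0, j) (exist _ a ca)).
Qed.

Let nextP s : exists s', next s s'.
Proof.
case: s => -[i j] [a ca]; rewrite /= in a ca *.
have [||k [b [ik ba cb]]] :=
  limit_step limS cS (@exB j) (fB j) (@cjA i) (fA i) (kg j) (a := a).
- by rewrite rmorph1 -f1 fK.
- by move=> p cp; rewrite ca // fK.
have [||l [a' [jl ab ca']]] :=
  limit_step limT cT (@exA k) (fA k) (@cjB j) (fB j) (kf k) (a := b).
- by rewrite rmorph1.
- by move=> p cp; rewrite cb // gK.
exists (existT (fun ij => {a : {lrmorphism A ij.1 -> B ij.2} | compat a})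
             (k, l) (exist _ a' ca')).
by split=> //; exists b.
Qed.

Lemma elliott_iso : alg_iso S T.
Proof.
have [s0 _] := state0; have /choice[nx nxP] := nextP.
pose s := fix s m := if m is m'.+1 then nx (s m') else s0.
have sP m : next (s m) (s m.+1) := nxP (s m).
have /dep_choice[b bE] m : exists b : {lrmorphism B (tag (s m)).2 -> A (tag (s m.+1)).1},
      (forall x, b (sval (tagged (s m)) x) = trans phi x (tag (s m.+1)).1) /\
      (forall y, sval (tagged (s m.+1)) (b y) = trans rho y (tag (s m.+1)).2).
  by case: (sP m).
apply: (@intertwining_iso F A B phi rho S T psi tau limS limT
  (fun m => (tag (s m)).1) (fun m => (tag (s m)).2)
  (fun m => sval (tagged (s m))) b).
- by move=> m; case: (sP m).
- by move=> m; case: (sP m).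
- by move=> m; case: (bE m).
by move=> m; case: (bE m).
Qed.

End Elliott.

Lemma K0_iso_alg_iso (F : comNzSemiRingType) (hF : semifield F)
    (S T : semiAlgType F) (f : K0 S -> K0 T) :
  ultramatricial S -> ultramatricial T -> K0_group_iso f ->
  f (K0_class (fgproj_regular S)) = K0_class (fgproj_regular T) ->
  (forall y : K0 T, (exists2 x : K0 S, K0_pos x & f x = y) <-> K0_pos y) ->
  alg_iso S T.
Proof.
move=> /ultramatricial_tower[ns [phi [psi limS]]].
move=> /ultramatricial_tower[nt [rho [tau limT]]] [fD [g fK gK]] f1 fpos.
apply: (@elliott_iso F _ _ phi rho S T psi tau limS limT _ _ _ _ _ _ _ _ f g fK gK).
- by apply: (mx_cancel_limit limS) => i; exact: matrix_prod_cancel.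
- by apply: (mx_cancel_limit limT) => i; exact: matrix_prod_cancel.
- by move=> i; exact: matrix_prod_exist.
- by move=> i; exact: matrix_prod_exist.
- by move=> i; exact: matrix_prod_conj.
- by move=> i; exact: matrix_prod_conj.
- by move=> i; exact: matrix_prod_spanned.
- by move=> i; exact: matrix_prod_spanned.
- exact: fD.
- by move=> x y; apply: (can_inj fK); rewrite fD !gK.
- by move=> x px; apply/fpos; exists x.
- by move=> y /fpos[x px <-]; rewrite fK.
by rewrite /el_class !mx_class1.
Qed.

(** * Functoriality of K_0 *)

Section K0Map.

Variables (S T : nzSemiRingType) (Phi : fgproj S -> fgproj T).
Hypothesis Phi_iso : forall P Q : fgproj S, smod_iso P Q -> smod_iso (Phi P) (Phi Q).
Hypothesis PhiD : forall P Q : fgproj S,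
  smod_iso (Phi (fgproj_dsum P Q)) (fgproj_dsum (Phi P) (Phi Q)).

Definition iso_class_map (a : iso_class S) : iso_class T :=
  to_iso_class (Phi (qrepr a)).

(** Acts on the components of a chosen representative; [K0_map_diff] shows that the choice is
    immaterial. *)
Definition K0_map (x : K0 S) : K0 T :=
  groth_diff (@iso_class_add T) (iso_class_map (qrepr x).1) (iso_class_map (qrepr x).2).

Lemma iso_class_mapE P : iso_class_map (to_iso_class P) = to_iso_class (Phi P).
Proof.
by apply/to_iso_class_eq; apply: Phi_iso; exact: (qreprP (@smod_iso_equiv S)).
Qed.

Lemma iso_class_mapD a b :
  iso_class_map (iso_class_add a b) =
  iso_class_add (iso_class_map a) (iso_class_map b).
Proof.
rewrite (iso_class_reprE a) (iso_class_reprE b) -to_iso_classD !iso_class_mapE.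
by rewrite -to_iso_classD; apply/to_iso_class_eq.
Qed.

Lemma K0_map_diff a b :
  K0_map (groth_diff (@iso_class_add S) a b) =
  groth_diff (@iso_class_add T) (iso_class_map a) (iso_class_map b).
Proof.
pose AS := @iso_class_addA S; pose CS := @iso_class_addC S.
apply/(groth_diff_eq (@iso_class_addA T) (@iso_class_addC T)).
have [k] := qreprP (groth_rel_equiv AS CS) (a, b).
rewrite -/(groth_diff _ a b) /= => e; exists (iso_class_map k).
by rewrite -!iso_class_mapD e.
Qed.

Lemma K0_map_class0 : smod_iso (Phi (fgproj0 S)) (fgproj0 T) ->
  forall P, K0_map (K0_class P) = K0_class (Phi P).
Proof.
move=> Phi0 P; rewrite K0_map_diff !iso_class_mapE.
by congr (groth_diff _ _ _); apply/to_iso_class_eq.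
Qed.

Lemma K0_mapD : {morph K0_map : x y / K0_add x y >-> K0_add x y}.
Proof.
move=> x y; rewrite (groth_reprE x) (groth_reprE y) /K0_add.
move: (qrepr x).1 (qrepr x).2 (qrepr y).1 (qrepr y).2 => a b c d.
rewrite (groth_add_diff (@iso_class_addA S) (@iso_class_addC S)) !K0_map_diff.
rewrite (groth_add_diff (@iso_class_addA T) (@iso_class_addC T)).
by rewrite !iso_class_mapD.
Qed.

End K0Map.

(** * Restriction of scalars along an isomorphism *)

Section Restriction.

Variables (R R' : nzSemiRingType) (s : {rmorphism R' -> R}) (V : lSemiModType R).

(** Restriction along an inverse isomorphism replaces extension of scalars and avoids tensor
    products. The morphism is a phantom argument, so that the type determines the action. *)
Definition restriction of {rmorphism R' -> R} : Type := V.
Local Notation W := (restriction s).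

HB.instance Definition _ := GRing.Nmodule.on W.

Definition restr_scale (a : R') (v : W) : W := s a *: (v : V).

Lemma restr_scaleA a b v : restr_scale a (restr_scale b v) = restr_scale (a * b) v.
Proof. by rewrite /restr_scale scalerA rmorphM. Qed.

Lemma restr_scale0 v : restr_scale 0 v = 0.
Proof. by rewrite /restr_scale rmorph0 scale0r. Qed.

Lemma restr_scale1 : left_id 1 restr_scale.
Proof. by move=> v; rewrite /restr_scale rmorph1 scale1r. Qed.

Lemma restr_scaleDr : right_distributive restr_scale +%R.
Proof. by move=> a u v; rewrite /restr_scale scalerDr. Qed.

Lemma restr_scaleDl v : {morph restr_scale^~ v : a b / a + b}.
Proof. by move=> a b; rewrite /restr_scale rmorphD scalerDl. Qed.

HB.instance Definition _ := GRing.Nmodule_isLSemiModule.Build R' W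
  restr_scaleA restr_scale0 restr_scale1 restr_scaleDr restr_scaleDl.

Lemma restr_scaleE (a : R') (v : W) : a *: v = s a *: (v : V) :> V.
Proof. by []. Qed.

End Restriction.

Section Isomorphism.

Variables (S T : nzSemiRingType).

Lemma rmorphism_converse (s : {rmorphism T -> S}) :
  exists s' : {rmorphism T^c -> S^c}, forall x, s' x = s x.
Proof.
pose h : T^c -> S^c := s.
have hD : nmod_morphism h by split=> [|x y]; [exact: (rmorph0 s)|exact: (rmorphD s)].
have hM : monoid_morphism h.
  by split=> [|x y]; [exact: (rmorph1 s)|exact: (rmorphM s)].
pose m1 := GRing.isNmodMorphism.Build _ _ h hD.
pose m2 := GRing.isMonoidMorphism.Build _ _ h hM.
by exists (HB.pack h m1 m2 : {rmorphism T^c -> S^c}).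
Qed.

Variables (s : {rmorphism T^c -> S^c}) (s' : {rmorphism S^c -> T^c}).
Hypotheses (sK : cancel s s') (s'K : cancel s' s).

(** The retraction is kept, with [s] and [s'] applied to the coordinates of the free semimodule. *)
Lemma restr_fgproj (P : fgproj S) :
  is_fgproj (restriction P s : rSemiModType T).
Proof.
have [n [f [g gK]]] := fgprojP P; exists n.
have [f' fE] : exists f' : {linear 'rV[T^c]_n -> restriction P s},
    forall v, f' v = f (map_mx s v).
  apply: linear_pack; split=> [a v | u v]; last by rewrite map_mxD linearD.
  by rewrite restr_scaleE -linearZ map_mxZ.
have [g' gE] : exists g' : {linear restriction P s -> 'rV[T^c]_n},
    forall v, g' v = map_mx s' (g v).
  apply: linear_pack; split=> [a v | u v]; last by rewrite linearD map_mxD.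
  by rewrite restr_scaleE linearZ map_mxZ sK.
exists f', g' => v; rewrite fE gE -map_mx_comp.
by rewrite (_ : map_mx _ _ = g v) ?gK //; apply/matrixP=> i j; rewrite !mxE /= s'K.
Qed.

Definition restr_proj (P : fgproj S) : fgproj T := FGProj (restr_fgproj P).

Lemma restr_proj_iso (P Q : fgproj S) :
  smod_iso P Q -> smod_iso (restr_proj P) (restr_proj Q).
Proof.
move=> [h [h' hK h'K]]; apply: (@smod_isoP T (restr_proj P) (restr_proj Q) h h') => //.
split=> [a v | u v]; last exact: linearD.
by rewrite restr_scaleE linearZ.
Qed.

Lemma restr_projD (P Q : fgproj S) :
  smod_iso (restr_proj (fgproj_dsum P Q)) (fgproj_dsum (restr_proj P) (restr_proj Q)).
Proof. by apply: (@smod_isoP _ _ _ id id). Qed.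

Lemma restr_proj0 : smod_iso (restr_proj (fgproj0 S)) (fgproj0 T).
Proof.
apply: (@smod_isoP _ (restr_proj (fgproj0 S)) (fgproj0 T) (fun=> 0) (fun=> 0)).
- by split=> [a v | u v]; rewrite ?scaler0 ?addr0.
- by move=> v; apply/matrixP=> i [].
by move=> v; apply/matrixP=> i [].
Qed.

Lemma restr_proj_regular :
  smod_iso (restr_proj (fgproj_regular S)) (fgproj_regular T).
Proof.
apply: (@smod_isoP _ (restr_proj (fgproj_regular S)) (fgproj_regular T) s' s) => //.
split=> [a v | u v]; last exact: rmorphD.
by rewrite restr_scaleE; rewrite -{2}(sK a); exact: rmorphM.
Qed.

End Isomorphism.

Lemma restr_projK (S T : nzSemiRingType) (s : {rmorphism T^c -> S^c})
    (s' : {rmorphism S^c -> T^c}) (sK : cancel s s') (s'K : cancel s' s)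
    (P : fgproj S) :
  smod_iso (restr_proj s'K sK (restr_proj sK s'K P)) P.
Proof.
apply: (@smod_isoP _ (restr_proj s'K sK (restr_proj sK s'K P)) P id id) => //.
by split=> // a v; rewrite !restr_scaleE s'K.
Qed.

Lemma restr_K0_mapK (S T : nzSemiRingType) (s : {rmorphism T^c -> S^c})
    (s' : {rmorphism S^c -> T^c}) (sK : cancel s s') (s'K : cancel s' s) :
  cancel (K0_map (restr_proj sK s'K)) (K0_map (restr_proj s'K sK)).
Proof.
move=> x; rewrite (groth_reprE x); move: (qrepr x).1 (qrepr x).2 => a b.
rewrite (K0_map_diff (@restr_proj_iso _ _ _ _ sK s'K) (@restr_projD _ _ _ _ sK s'K)).
rewrite (K0_map_diff (@restr_proj_iso _ _ _ _ s'K sK) (@restr_projD _ _ _ _ s'K sK)).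
have e c : iso_class_map (restr_proj s'K sK) (iso_class_map (restr_proj sK s'K) c) = c.
  rewrite (iso_class_reprE c) (iso_class_mapE (@restr_proj_iso _ _ _ _ sK s'K)).
  rewrite (iso_class_mapE (@restr_proj_iso _ _ _ _ s'K sK)).
  by apply/to_iso_class_eq; exact: restr_projK.
by rewrite !e.
Qed.

Lemma alg_iso_K0_iso (F : comNzSemiRingType) (S T : semiAlgType F) :
  alg_iso S T ->
  exists f : K0 S -> K0 T,
     [/\ K0_group_iso f,
         f (K0_class (fgproj_regular S)) = K0_class (fgproj_regular T)
       & forall y : K0 T, (exists2 x : K0 S, K0_pos x & f x = y) <-> K0_pos y].
Proof.
move=> [th /lrmorphism_inv[th' [thK th'K]]].
(* Restriction is contravariant, so the map from [K0 S] to [K0 T] comes from the inverse [th']. *)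
have [s' s'E] := rmorphism_converse th; have [s sE] := rmorphism_converse th'.
have sK : cancel s s' by move=> x; rewrite s'E sE; exact: th'K.
have s'K : cancel s' s by move=> x; rewrite sE s'E; exact: thK.
pose Phi := restr_proj sK s'K; pose Psi := restr_proj s'K sK.
have iso1 := @restr_proj_iso _ _ _ _ sK s'K.
have iso2 := @restr_proj_iso _ _ _ _ s'K sK.
have D1 := @restr_projD _ _ _ _ sK s'K.
have D2 := @restr_projD _ _ _ _ s'K sK.
have fE := K0_map_class0 iso1 D1 (restr_proj0 sK s'K).
have gE := K0_map_class0 iso2 D2 (restr_proj0 s'K sK).
exists (K0_map Phi); split.
- split; first exact: K0_mapD.
  by exists (K0_map Psi); exact: restr_K0_mapK.
- rewrite fE; congr (groth_in _ _ _); apply/to_iso_class_eq.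
  exact: restr_proj_regular.
move=> y; split=> [[x [P ->] <-] | [P ->]]; first by exists (Phi P); exact: fE.
exists (K0_class (Psi P)); first by exists (Psi P).
by rewrite -gE; exact: restr_K0_mapK.
Qed.

Theorem theorem6p23 (F : comNzSemiRingType) (hF : semifield F)
    (S T : semiAlgType F) (hS : ultramatricial S) (hT : ultramatricial T) :
  (exists f : K0 S -> K0 T,
     [/\ K0_group_iso f,
         f (K0_class (fgproj_regular S)) = K0_class (fgproj_regular T)
       & forall y : K0 T, (exists2 x : K0 S, K0_pos x & f x = y) <-> K0_pos y])
  <-> alg_iso S T.
Proof.
split=> [[f [fiso f1 fpos]] |]; last exact: alg_iso_K0_iso.
exact: K0_iso_alg_iso fiso f1 fpos.
Qed.
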